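(* Let $k$ be a commutative ring with identity, let $\mathcal{A}$ be a unital (associative, not necessarily commutative) $k$-algebra which is free as a $k$-module, let $\mathbb{M}$ be an $\mathcal{A}$-bimodule, and let $P_{n+1}$ be the $(n+1)$-gon. Then for $0<i\le n$ there is an isomorphism of $k$-modules $$\hat H^i_{\mathcal{A},\mathbb{M}}(P_{n+1}) \cong H_{n-i}(\mathcal{A},\mathbb{M}),$$ where the left side is the $\mathbb{M}$-reduced graph cohomology of the directed polygon and the right side is Hochschild homology of $\mathcal{A}$ with coefficients in $\mathbb{M}$. Furthermore, if $\mathcal{A}$ is a graded algebra and $\mathbb{M}$ is a coherently graded $\mathcal{A}$-bimodule, then $\hat H^{i,j}_{\mathcal{A},\mathbb{M}}(P_{n+1}) \cong H_{n-i,j}(\mathcal{A},\mathbb{M})$ for $0<i\le n$ and every $j$.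
   Context: All tensor products are over $k$. Bimodules are unital ($1m=m1=m$), and the actions of $k$ and $\mathcal{A}$ are compatible: $m(\lambda a)=(m\lambda)a=\lambda(ma)$ for $\lambda\in k$, and similarly on the left. **Hochschild homology.** $C_r(\mathcal{A},\mathbb{M})=\mathbb{M}\otimes\mathcal{A}^{\otimes r}$ with boundary $b=\sum_{i=0}^r(-1)^id_i$, where $d_0(m,a_1,\dots,a_r)=(ma_1,a_2,\dots,a_r)$, $d_i(m,a_1,\dots,a_r)=(m,a_1,\dots,a_ia_{i+1},\dots,a_r)$ for $1\le i\le r-1$, and $d_r(m,a_1,\dots,a_r)=(a_rm,a_1,\dots,a_{r-1})$. $H_r(\mathcal{A},\mathbb{M})$ is the $r$-th homology of this complex. **Graph cohomology of the directed polygon.** For $N\ge 2$, $P_N$ is the cycle with $N$ vertices $v_0,\dots,v_{N-1}$ and $N$ edges, directed anticlockwise: $e_j$ goes from $v_{j-1}$ to $v_j$ (indices mod $N$), $j=1,\dots,N$; $v_0$ is the base vertex. Let $E$ be the set of edges. For $s\subset E$ let $[P_N:s]$ be the subgraph with all vertices and edge set $s$, and let $k(s)$ be its number of connected components. List the components in cyclic order following the orientation, starting with the component containing $v_0$. Put $\hat\Phi(s)=\mathbb{M}\otimes\mathcal{A}^{\otimes (k(s)-1)}$, where the factor $\mathbb{M}$ is attached to the component containing $v_0$ and the copies of $\mathcal{A}$ are attached to the other components in order. An element of the factor attached to a component is called its weight. For $e\in E\setminus s$ define $\hat\Phi(s\subset s\cup e):\hat\Phi(s)\to\hat\Phi(s\cup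 e)$ as follows. If $e$ joins two different components of $[P_N:s]$, with $x$ the weight of the component containing the initial vertex of $e$ and $y$ the weight of the component containing the terminal vertex of $e$, then the merged component receives the weight $xy$ (product in $\mathcal{A}$, or the left or right action on $\mathbb{M}$ if one of the two is in $\mathbb{M}$), and all other weights are unchanged. If both endpoints of $e$ lie in the same component of $[P_N:s]$, then the map is zero. The cochain complex is $C^i=\bigoplus_{|s|=i}\hat\Phi(s)$ with differential which on $\hat\Phi(s)$ is $d=\sum_{e\notin s}(-1)^{t(s,e)}\hat\Phi(s\subset s\cup e)$, where $E$ is given a fixed linear ordering and $t(s,e)$ is the number of elements of $s$ smaller than $e$. Its $i$-th cohomology is $\hat H^i_{\mathcal{A},\mathbb{M}}(P_N)$; it does not depend on the ordering of $E$. **Gradings.** ''Coherently graded'' means that $\mathbb{M}$ is a graded bimodule over the graded algebra $\mathcal{A}$ (actions are additive on degrees). Both complexes above are then graded by total degree in the tensor products, with degree-preserving (co)boundary maps; $H_{r,j}$ and $\hat H^{i,j}$ denote the parts of internal degree $j$. *)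

(* Defs.v *)
(* The classical axioms of mathcomp.classical.boolp are used to form quotients
   by submodules whose membership need not be decidable. *)
From HB Require Import structures.
From mathcomp Require Import all_boot all_order all_algebra.
From mathcomp Require Import boolp functions zify.

Set Implicit Arguments.
Unset Strict Implicit.
Unset Printing Implicit Defensive.

Import GRing.Theory.
Local Open Scope ring_scope.
Local Open Scope quotient_scope.

Section Submodules.
Variables (k : comPzRingType) (V : lmodType k).

Definition lspan (P : V -> Prop) : {pred V} := fun x =>
  `[< exists s : seq (k * V),
        (forall p, p \in s -> P p.2) /\ x = \sum_(p <- s) p.1 *: p.2 >].

Lemma lspan_submod_closed P : submod_closed (lspan P).
Proof.
split=> [|c u v /asboolP[s [Ps ->]] /asboolP[t [Pt ->]]]; apply/asboolP.
  by exists [::]; rewrite big_nil.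
exists ([seq (c * p.1, p.2) | p <- s] ++ t); split=> [p|].
  by rewrite mem_cat => /orP[/mapP[q /Ps Pq ->] | /Pt].
rewrite big_cat big_map /= scaler_sumr; congr (_ + _).
by apply: eq_bigr => p _; rewrite scalerA.
Qed.

HB.instance Definition _ P :=
  GRing.isSubmodClosed.Build k V (lspan P) (lspan_submod_closed P).

Lemma lspan_gen (P : V -> Prop) x : P x -> x \in lspan P.
Proof.
move=> Px; apply/asboolP; exists [:: (1, x)]; rewrite big_seq1 scale1r.
by split=> // p; rewrite inE => /eqP ->.
Qed.

Definition inter (S T : {pred V}) : {pred V} :=
  fun x => (x \in S) && (x \in T).

Lemma inter_submod_closed (S T : submodClosed V) : submod_closed (inter S T).
Proof.
have E x : (x \in inter S T) = (x \in S) && (x \in T) by [].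
split=> [|c u v]; rewrite !E ?rpred0 // => /andP[Su Tu] /andP[Sv Tv].
by apply/andP; split; apply: rpredD => //; apply: rpredZ.
Qed.

HB.instance Definition _ (S T : submodClosed V) :=
  GRing.isSubmodClosed.Build k V (inter S T) (inter_submod_closed S T).

Record submod (S : submodClosed V) :=
  Submod { submod_val :> V; submod_valP : submod_val \in S }.

HB.instance Definition _ S := [isSub for @submod_val S].
HB.instance Definition _ S := [Choice of submod S by <:].
HB.instance Definition _ S := [SubChoice_isSubLmodule of submod S by <:].

(* [submodClosed] does not record closure under opposites, which
   [Quotient.quot] requires: this is S again, with that structure. *)
Definition zsubmod (S : submodClosed V) : {pred V} := fun x => x \in S.

Lemma zsubmod_submod_closed (S : submodClosed V) : submod_closed (zsubmod S).
Proof.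
have E x : (x \in zsubmod S) = (x \in S) by [].
split=> [|c u v]; rewrite !E; first exact: rpred0.
by move=> Su Sv; apply: rpredD => //; apply: rpredZ.
Qed.

HB.instance Definition _ (S : submodClosed V) :=
  GRing.isSubmodClosed.Build k V (zsubmod S) (zsubmod_submod_closed S).

Definition quotmod (S : submodClosed V) : Type := Quotient.quot (zsubmod S).

Section QuotMod.
Variable S : submodClosed V.

HB.instance Definition _ := GRing.Zmodule.on (quotmod S).
HB.instance Definition _ := Quotient.on (quotmod S).

Definition qproj (x : V) : quotmod S := \pi x.

Lemma qproj_eq x y : qproj x = qproj y <-> x - y \in S.
Proof.
rewrite (_ : (x - y \in S) = (x - y \in zsubmod S)) // Quotient.idealrBE.
by split=> [/eqP|/eqP].
Qed.

Lemma qprojD x y : qproj (x + y) = qproj x + qproj y.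
Proof. exact: raddfD. Qed.

Lemma qproj_repr x : qproj (repr x) = x.
Proof. exact: reprK. Qed.

Definition qscale (c : k) (x : quotmod S) : quotmod S :=
  qproj (c *: repr x).

Lemma qprojZ c x : qproj (c *: x) = qscale c (qproj x).
Proof.
by apply/qproj_eq; rewrite -scalerBr rpredZ //; apply/qproj_eq; rewrite qproj_repr.
Qed.

Fact qscaleA a b x : qscale a (qscale b x) = qscale (a * b) x.
Proof. by rewrite -[x]qproj_repr -!qprojZ scalerA. Qed.
Fact qscale1 : left_id 1 qscale.
Proof. by move=> x; rewrite -[x]qproj_repr -qprojZ scale1r. Qed.
Fact qscaleDr : right_distributive qscale +%R.
Proof.
move=> c x y; rewrite -[x]qproj_repr -[y]qproj_repr.
by rewrite -qprojD -!qprojZ -qprojD scalerDr.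
Qed.
Fact qscaleDl x : {morph qscale^~ x : a b / a + b}.
Proof. by move=> a b; rewrite -[x]qproj_repr -!qprojZ -qprojD scalerDl. Qed.

HB.instance Definition _ := GRing.Zmodule_isLmodule.Build k (quotmod S)
  qscaleA qscale1 qscaleDr qscaleDl.

Fact qproj_linear : linear qproj.
Proof. by move=> c x y; rewrite qprojD qprojZ. Qed.
HB.instance Definition _ := GRing.isLinear.Build k V (quotmod S) *:%R qproj
  qproj_linear.

End QuotMod.

Definition relsub (S : submodClosed V) (T : {pred V}) : {pred submod S} :=
  fun x => submod_val x \in T.

Lemma relsub_submod_closed (S T : submodClosed V) :
  submod_closed (@relsub S T).
Proof.
have E x : (x \in @relsub S T) = (submod_val x \in T) by [].
split=> [|c u v]; rewrite !E; first exact: rpred0.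
by move=> Tu Tv; apply: rpredD => //; apply: rpredZ.
Qed.

HB.instance Definition _ (S T : submodClosed V) :=
  GRing.isSubmodClosed.Build k (submod S) (@relsub S T)
    (relsub_submod_closed S T).

End Submodules.

(* S / (S :&: T) *)
Definition subquot (k : comPzRingType) (V : lmodType k)
    (S T : submodClosed V) : lmodType k :=
  quotmod (@relsub k V S T).

Section Homology.
Variables (k : comPzRingType) (U V W : lmodType k).

Definition kerp (g : V -> W) : {pred V} := fun x => g x == 0.

Lemma kerp_submod_closed (g : {linear V -> W}) : submod_closed (kerp g).
Proof.
have E x : (x \in kerp g) = (g x == 0) by [].
split=> [|c u v]; rewrite !E ?linear0 //.
by rewrite linearP => /eqP-> /eqP->; rewrite scaler0 addr0.
Qed.

HB.instance Definition _ (g : {linear V -> W}) :=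
  GRing.isSubmodClosed.Build k V (kerp g) (kerp_submod_closed g).

Definition imgp (f : U -> V) (S : {pred U}) : {pred V} :=
  fun y => `[< exists2 x, x \in S & y = f x >].

Lemma imgp_submod_closed (f : {linear U -> V}) (S : submodClosed U) :
  submod_closed (imgp f S).
Proof.
split=> [|c u v]; first by apply/asboolP; exists 0; rewrite ?rpred0 ?linear0.
move=> /asboolP[x Sx ->] /asboolP[y Sy ->]; apply/asboolP.
by exists (c *: x + y); rewrite ?rpredD ?rpredZ // linearP.
Qed.

HB.instance Definition _ (f : {linear U -> V}) (S : submodClosed U) :=
  GRing.isSubmodClosed.Build k V (imgp f S) (imgp_submod_closed f S).

Definition fullp : {pred U} := fun _ => true.

Lemma fullp_submod_closed : submod_closed fullp.
Proof. by []. Qed.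

HB.instance Definition _ :=
  GRing.isSubmodClosed.Build k U fullp fullp_submod_closed.

End Homology.

(* Homology at V of U --f--> V --g--> W. *)
Definition homology (k : comPzRingType) (U V W : lmodType k)
    (f : {linear U -> V}) (g : {linear V -> W}) : lmodType k :=
  subquot (kerp g) (imgp f (@fullp k U)).

(* Homology at V' of the subcomplex U' --f--> V' --g--> W, for submodules U' of
   U and V' of V with f (U') included in V'. *)
Definition homology_on (k : comPzRingType) (U V W : lmodType k)
    (U' : submodClosed U) (V' : submodClosed V)
    (f : {linear U -> V}) (g : {linear V -> W}) : lmodType k :=
  subquot (inter V' (kerp g)) (imgp f U').

Definition lmod_iso (k : comPzRingType) (V W : lmodType k) : Prop :=
  exists f : {linear V -> W}, bijective f.

(* The direct sum of a finite family of modules, as the product. *)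
Definition dirsum (k : comPzRingType) (I : finType) (V : I -> lmodType k)
  : Type := forall i, V i.

Section DirectSum.
Variables (k : comPzRingType) (I : finType) (V : I -> lmodType k).
Local Notation D := (dirsum V).

HB.instance Definition _ := Choice.copy D (forall i, V i).

Definition ds_zero : D := fun=> 0.
Definition ds_opp (x : D) : D := fun i => - x i.
Definition ds_add (x y : D) : D := fun i => x i + y i.
Definition ds_scale (c : k) (x : D) : D := fun i => c *: x i.

Fact ds_addA : associative ds_add.
Proof. by move=> x y z; apply/functional_extensionality_dep => i; apply: addrA. Qed.
Fact ds_addC : commutative ds_add.
Proof. by move=> x y; apply/functional_extensionality_dep => i; apply: addrC. Qed.
Fact ds_add0 : left_id ds_zero ds_add.
Proof. by move=> x; apply/functional_extensionality_dep => i; apply: add0r. Qed.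
Fact ds_addN : left_inverse ds_zero ds_opp ds_add.
Proof. by move=> x; apply/functional_extensionality_dep => i; apply: addNr. Qed.
HB.instance Definition _ :=
  GRing.isZmodule.Build D ds_addA ds_addC ds_add0 ds_addN.

Fact ds_scaleA a b x : ds_scale a (ds_scale b x) = ds_scale (a * b) x.
Proof. by apply/functional_extensionality_dep => i; apply: scalerA. Qed.
Fact ds_scale1 : left_id 1 ds_scale.
Proof. by move=> x; apply/functional_extensionality_dep => i; apply: scale1r. Qed.
Fact ds_scaleDr : right_distributive ds_scale +%R.
Proof. by move=> c x y; apply/functional_extensionality_dep => i; apply: scalerDr. Qed.
Fact ds_scaleDl x : {morph ds_scale^~ x : a b / a + b}.
Proof. by move=> a b; apply/functional_extensionality_dep => i; apply: scalerDl. Qed.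
HB.instance Definition _ := GRing.Zmodule_isLmodule.Build k D
  ds_scaleA ds_scale1 ds_scaleDr ds_scaleDl.

Definition dirsum_pred (S : forall i, {pred V i}) : {pred D} :=
  fun x => [forall i, x i \in S i].

Lemma dirsum_pred_submod_closed (S : forall i, submodClosed (V i)) :
  submod_closed (dirsum_pred S).
Proof.
split=> [|c u v]; first by apply/forallP => i; apply: rpred0.
move=> /forallP Su /forallP Sv; apply/forallP => i.
have Scu : c *: u i \in S i by apply: rpredZ; apply: Su.
exact: (rpredD Scu (Sv i)).
Qed.

HB.instance Definition _ (S : forall i, submodClosed (V i)) :=
  GRing.isSubmodClosed.Build k D (dirsum_pred S) (dirsum_pred_submod_closed S).

End DirectSum.

Section FreeModule.
Variables (k : comPzRingType) (T : choiceType).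

Definition finsupp : {pred T -> k^o} :=
  fun f => `[< exists s : seq T, forall t, t \notin s -> f t = 0 >].

Lemma finsupp_submod_closed : submod_closed finsupp.
Proof.
split=> [|c f g /asboolP[s fs] /asboolP[t gt]]; apply/asboolP.
  by exists [::].
exists (s ++ t) => x; rewrite mem_cat negb_or => /andP[/fs fx /gt gx].
by rewrite [LHS](_ : _ = c * f x + g x) // fx gx mulr0 addr0.
Qed.

HB.instance Definition _ :=
  GRing.isSubmodClosed.Build k (T -> k^o) finsupp finsupp_submod_closed.

Definition freemod : lmodType k := submod finsupp.

Fact fgen_subproof (t : T) : (fun u => (u == t)%:R : k^o) \in finsupp.
Proof. by apply/asboolP; exists [:: t] => u; rewrite inE => /negPf ->. Qed.

Definition fgen (t : T) : freemod := Submod (fgen_subproof t).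

Definition fsupp (x : freemod) : seq T :=
  undup (projT1 (cid (asboolP _ (submod_valP x)))).

Lemma fsuppP (x : freemod) t : t \notin fsupp x -> submod_val x t = 0.
Proof. by rewrite mem_undup; case: cid => s /= xs /xs. Qed.

Variables (V : lmodType k) (b : T -> V).

(* The linear map sending the generator t to b t. *)
Definition flift (x : freemod) : V :=
  \sum_(t <- fsupp x) (submod_val x t) *: b t.

Lemma flift_widen (x : freemod) s : uniq s ->
    (forall t, t \notin s -> submod_val x t = 0) ->
  flift x = \sum_(t <- s) (submod_val x t) *: b t.
Proof.
move=> us xs; rewrite /flift.
have aux (s1 s2 : seq T) : uniq s1 -> uniq s2 ->
    (forall t, t \notin s2 -> submod_val x t = 0) ->
  \sum_(t <- s1) submod_val x t *: b t =
  \sum_(t <- s1 | t \in s2) submod_val x t *: b t.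
  move=> u1 u2 x2; rewrite (bigID (mem s2)) /= [X in _ + X]big1 ?addr0 //.
  by move=> t /x2 ->; rewrite scale0r.
rewrite (aux _ s) ?undup_uniq // (aux s (fsupp x)) ?undup_uniq //;
  last exact: fsuppP.
rewrite -big_filter -[RHS]big_filter; apply/perm_big/uniq_perm.
- by rewrite filter_uniq ?undup_uniq.
- by rewrite filter_uniq.
by move=> t; rewrite !mem_filter andbC.
Qed.

Fact flift_linear : linear flift.
Proof.
move=> c x y; pose s := undup (fsupp x ++ fsupp y).
have us : uniq s by rewrite undup_uniq.
have sx t : t \notin s -> submod_val x t = 0.
  by rewrite mem_undup mem_cat negb_or => /andP[/fsuppP].
have sy t : t \notin s -> submod_val y t = 0.
  by rewrite mem_undup mem_cat negb_or => /andP[_ /fsuppP].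
rewrite (flift_widen us sx) (flift_widen us sy) (@flift_widen _ s) //; last first.
  move=> t st; transitivity (c * submod_val x t + submod_val y t) => //.
  by rewrite sx ?sy // mulr0 addr0.
rewrite scaler_sumr -big_split; apply: eq_bigr => t _ /=.
by rewrite scalerA -scalerDl.
Qed.

HB.instance Definition _ :=
  GRing.isLinear.Build k freemod V *:%R flift flift_linear.

Lemma flift_gen t : flift (fgen t) = b t.
Proof.
rewrite (@flift_widen _ [:: t]) ?big_seq1 //= ?eqxx ?scale1r // => u.
by rewrite inE => /negPf ->.
Qed.

End FreeModule.

Lemma freemodE (k : comPzRingType) (T : choiceType) (x : freemod k T) :
  x = \sum_(t <- fsupp x) submod_val x t *: fgen k t.
Proof.
apply: val_inj; rewrite raddf_sum /=; apply/funext => u; rewrite fct_sumE /=.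
transitivity (\sum_(t <- fsupp x) submod_val x t * (u == t)%:R); last by [].
case: (boolP (u \in fsupp x)) => [ux|/[dup] nux /fsuppP ->].
  rewrite (bigD1_seq u) ?undup_uniq //= big1 ?eqxx ?mulr1 ?addr0 // => t tu.
  by rewrite eq_sym (negPf tu) mulr0.
rewrite big_seq big1 // => t tx.
by case: eqP tx nux => [->->|]; rewrite ?mulr0.
Qed.

(* V has a basis. *)
Definition free_module (k : comPzRingType) (V : lmodType k) : Prop :=
  exists (B : choiceType) (b : B -> V), bijective (flift b).

Section Tensor.
Variables (k : comPzRingType) (V W : lmodType k) (r : nat).

Definition upd (a : 'I_r -> W) (i : 'I_r) (x : W) : 'I_r -> W :=
  fun j => if j == i then x else a j.

Definition multilinear (U : lmodType k) (f : V -> ('I_r -> W) -> U) : Prop :=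
  (forall c m m' a, f (c *: m + m') a = c *: f m a + f m' a) /\
  (forall i c x y m a,
     f m (upd a i (c *: x + y)) = c *: f m (upd a i x) + f m (upd a i y)).

Local Notation F := (freemod k (V * ('I_r -> W))%type).
Local Notation gen m a := (fgen k (m : V, a : 'I_r -> W) : F).

Variant tensor_rel : F -> Prop :=
| TensorRelL c m m' a :
    tensor_rel (gen (c *: m + m') a - (c *: gen m a + gen m' a))
| TensorRelR i c x y m a :
    tensor_rel (gen m (upd a i (c *: x + y))
                - (c *: gen m (upd a i x) + gen m (upd a i y))).

(* V (x) W^{(x) r} over k: the free module on V * W^r modulo multilinearity *)
Definition tensor : lmodType k := quotmod (lspan tensor_rel).

(* m (x) a_1 (x) ... (x) a_r, with a_1, ..., a_r given as a 0, ..., a (r-1) *)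
Definition pure (m : V) (a : 'I_r -> W) : tensor := qproj _ (gen m a).

Lemma pure_multilinear : multilinear pure.
Proof.
split=> *; rewrite /pure -linearP; apply/qproj_eq/lspan_gen.
  exact: TensorRelL.
exact: TensorRelR.
Qed.

Lemma tensorE (x : tensor) :
  exists s : seq (k * (V * ('I_r -> W))),
    x = \sum_(p <- s) p.1 *: pure p.2.1 p.2.2.
Proof.
rewrite -[x]qproj_repr; set y := repr _.
exists [seq (submod_val y t, t) | t <- fsupp y].
rewrite big_map [in LHS](freemodE y) linear_sum; apply: eq_bigr => t _ /=.
by rewrite linearZ /pure -surjective_pairing.
Qed.

Record multilin (U : lmodType k) :=
  Multilin { mlfun :> V -> ('I_r -> W) -> U; mlfunP : multilinear mlfun }.

Section Lift.
Variables (U : lmodType k) (f : multilin U).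

Let g (x : F) : U := flift (fun p => f p.1 p.2) x.

Definition tlift (x : tensor) : U := g (repr x).

Fact tlift_subproof x : x \in lspan tensor_rel -> g x = 0.
Proof.
case/asboolP=> s [Ps ->]; rewrite /g linear_sum big_seq big1 // => p /Ps Pp.
rewrite linearZ /=; case: (mlfunP f) => fL fR; case: Pp => *;
  by rewrite linearB linearP /= !flift_gen /= ?fL ?fR subrr scaler0.
Qed.

Fact tlift_qproj x : tlift (qproj _ x) = g x.
Proof.
rewrite /tlift; apply/eqP; rewrite -subr_eq0 -linearB; apply/eqP.
by apply: tlift_subproof; apply/qproj_eq; rewrite qproj_repr.
Qed.

Fact tlift_linear : linear tlift.
Proof.
move=> c x y; rewrite -[x]qproj_repr -[y]qproj_repr -linearP !tlift_qproj.
by rewrite /g linearP.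
Qed.

HB.instance Definition _ :=
  GRing.isLinear.Build k tensor U *:%R tlift tlift_linear.

Lemma tlift_pure m a : tlift (pure m a) = f m a.
Proof. by rewrite tlift_qproj /g flift_gen. Qed.

End Lift.

End Tensor.

Arguments pure {k V W r} m a.

(* A criterion for (m, a) |-> pure (p m a) (q a) to be multilinear: every
   coordinate of a enters exactly one coordinate of the result, linearly. *)
Lemma pure_comp_multilinear (k : comPzRingType) (V W : lmodType k) (r s : nat)
    (p : V -> ('I_r -> W) -> V) (q : ('I_r -> W) -> ('I_s -> W)) :
    (forall c m m' a, p (c *: m + m') a = c *: p m a + p m' a) ->
    (forall i,
      (forall c x y m a, p m (upd a i (c *: x + y)) =
          c *: p m (upd a i x) + p m (upd a i y)) /\
      (forall x a, q (upd a i x) = q a) \/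
      (forall x m a, p m (upd a i x) = p m a) /\
      (exists j, forall a, exists2 g : W -> W, linear g &
         forall x, q (upd a i x) = upd (q a) j (g x))) ->
  multilinear (fun m a => pure (p m a) (q a)).
Proof.
move=> pL pqR; have [PL PR] := @pure_multilinear k V W s.
split=> [c m m' a|i c x y m a]; first by rewrite pL PL.
case: (pqR i) => [[pi qi]|[pi [j qi]]]; first by rewrite pi !qi PL.
have [g gL ga] := qi a.
by rewrite !pi !ga gL PR.
Qed.

HB.mixin Record isBimodule (k : comPzRingType) (A : algType k) M
    of GRing.Lmodule k M := {
  lact : A -> M -> M;
  ract : M -> A -> M;
  lact_linearl : forall m, linear (lact^~ m);
  lact_linearr : forall a, linear (lact a);
  ract_linearl : forall a, linear (ract^~ a);
  ract_linearr : forall m, linear (ract m);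
  lact1 : forall m, lact 1 m = m;
  ract1 : forall m, ract m 1 = m;
  lactM : forall a b m, lact (a * b) m = lact a (lact b m);
  ractM : forall m a b, ract m (a * b) = ract (ract m a) b;
  lractA : forall a m b, ract (lact a m) b = lact a (ract m b)
}.
#[short(type="bimodType")]
HB.structure Definition Bimodule (k : comPzRingType) (A : algType k) :=
  {M of GRing.Lmodule k M & isBimodule k A M}.

Section Hochschild.
Variables (k : comPzRingType) (A : algType k) (M : bimodType A).

Definition chains (r : nat) : lmodType k := tensor M A r.

(* The face d_i (0 <= i <= r.+1) of C_(r.+1), whose elements
   (m, a_1, ..., a_(r.+1)) are stored as a 0, ..., a r. *)
Definition face_mod (r : nat) (i : 'I_r.+2) (m : M) (a : 'I_r.+1 -> A) : M :=
  if i == 0%N :> nat then ract m (a ord0)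
  else if i == r.+1 :> nat then lact (a ord_max) m else m.

Definition face_alg (r : nat) (i : 'I_r.+2) (a : 'I_r.+1 -> A) : 'I_r -> A :=
  fun j => if (j.+1 < i)%N then a (widen_ord (leqnSn r) j)
           else if j.+1 == i :> nat then
             a (widen_ord (leqnSn r) j) * a (lift ord0 j)
           else a (lift ord0 j).

Fact face_multilinear r (i : 'I_r.+2) :
  multilinear (fun m a => pure (face_mod i m a) (face_alg i a) : chains r).
Proof.
apply: (@pure_comp_multilinear _ _ _ _ _ (face_mod i) (face_alg i))
  => [c m m' a|l]; rewrite /face_mod.
  by case: ifP => _; [exact: ract_linearl | case: ifP => _ //; exact: lact_linearr].
have [i0|i_neq0] := eqVneq (i : nat) 0%N.
  have [->|l_neq0] := eqVneq l ord0.
    left; split=> [c x y m a|x a]; first by rewrite /upd eqxx; exact: ract_linearr.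
    by apply/funext => j; rewrite /face_alg /upd i0.
  right; split=> [x m a|]; first by rewrite /upd eq_sym (negPf l_neq0).
  have lt_l : (l.-1 < r)%N by have := ltn_ord l; move: l_neq0; rewrite -val_eqE /=; lia.
  exists (Ordinal lt_l) => a; exists id => // x.
  apply/funext => j; rewrite /face_alg /upd i0 /= -!val_eqE /= /bump /=.
  by congr (if _ then _ else _); move: l_neq0; rewrite -val_eqE /=; lia.
have [ir|i_neqr] := eqVneq (i : nat) r.+1.
  have [->|l_neqr] := eqVneq l ord_max.
    left; split=> [c x y m a|x a]; first by rewrite /upd eqxx; exact: lact_linearl.
    apply/funext => j; rewrite /face_alg /upd ir ltnS ltn_ord -val_eqE /=.
    by rewrite ltn_eqF.
  right; split=> [x m a|]; first by rewrite /upd eq_sym (negPf l_neqr).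
  have lt_l : (l < r)%N by have := ltn_ord l; move: l_neqr; rewrite -val_eqE /=; lia.
  exists (Ordinal lt_l) => a; exists id => // x.
  by apply/funext => j; rewrite /face_alg /upd ir ltnS ltn_ord.
right; split=> //; have lt_i := ltn_ord i; have lt_l := ltn_ord l.
have [l_lt|l_ge] := ltnP l i.
  have lt_l' : (l < r)%N by lia.
  exists (Ordinal lt_l') => a.
  exists (fun x => if l.+1 == i :> nat then x * a (lift ord0 (Ordinal lt_l')) else x).
    by move=> c x y /=; case: ifP => //; rewrite mulrDl scalerAl.
  move=> x; apply/funext => j; rewrite /face_alg /upd -!val_eqE /= /bump /= !add1n.
  have [jl|jl] := eqVneq (j : nat) l.
    have -> : Ordinal lt_l' = j by exact: val_inj.
    have [li|li] := eqVneq l.+1 (i : nat); last first.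
      by have -> : (j.+1 < i)%N by lia.
    have -> : (j.+1 < i)%N = false by lia.
    have -> : j.+1 == i :> nat by lia.
    by have -> : (j.+1 == l :> nat) = false by lia.
  case: (ltngtP j.+1 i) => // ji.
    by have -> : (j.+1 == l :> nat) = false by lia.
  by have -> : (j.+1 == l :> nat) = false by lia.
have lt_l' : (l.-1 < r)%N by lia.
exists (Ordinal lt_l') => a.
exists (fun x => if l == i :> nat then a (widen_ord (leqnSn r) (Ordinal lt_l')) * x
                 else x).
  by move=> c x y /=; case: ifP => //; rewrite mulrDr scalerAr.
move=> x; apply/funext => j; rewrite /face_alg /upd -!val_eqE /= /bump /= !add1n.
have [jl|jl] := eqVneq (j : nat) l.-1.
  have -> : Ordinal lt_l' = j by exact: val_inj.
  have -> : (j.+1 < i)%N = false by lia.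
  have -> : j.+1 == l :> nat by lia.
  have -> : (j.+1 == i :> nat) = (l == i :> nat) by lia.
  by have -> : (j == l :> nat) = false by lia.
have -> : (j.+1 == l :> nat) = false by lia.
by case: (ltngtP j.+1 i) => // ji; have -> : (j == l :> nat) = false by lia.
Qed.

Definition face r (i : 'I_r.+2) : {linear chains r.+1 -> chains r} :=
  tlift (Multilin (face_multilinear i)).

Definition hboundary_fun r (x : chains r) : chains r.-1 :=
  match r return chains r -> chains r.-1 with
  | 0 => fun=> 0
  | r'.+1 => fun x => \sum_(i < r'.+2) (-1) ^+ i *: face i x
  end x.

Fact hboundary_linear r : linear (@hboundary_fun r).
Proof.
case: r => [|r] c x y /=; first by rewrite scaler0 addr0.
rewrite scaler_sumr -big_split; apply: eq_bigr => i _ /=.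
by rewrite linearP scalerDr !scalerA mulrC.
Qed.

HB.instance Definition _ r := GRing.isLinear.Build k (chains r) (chains r.-1)
  *:%R (@hboundary_fun r) (@hboundary_linear r).

(* b : C_r -> C_(r-1), with b = 0 on C_0 *)
Definition hboundary r : {linear chains r -> chains r.-1} := @hboundary_fun r.

Definition HH (r : nat) : lmodType k := homology (hboundary r.+1) (hboundary r).

End Hochschild.

Section Polygon.
(* The polygon with vertices v_0, ..., v_n; an edge is named by its initial
   vertex, so that e : edge goes from e to ordS e. *)
Variable n : nat.
Local Notation vertex := 'I_n.+1.
Local Notation edge := 'I_n.+1.
Implicit Types (s : {set edge}) (e : edge) (u v w : vertex).

Definition adj s : rel vertex :=
  [rel u v | ((u \in s) && (v == ordS u)) || ((v \in s) && (u == ordS v))].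

Definition ncomp s : nat := n_comp (adj s) predT.

(* The components of [P:s], each given by its smallest vertex (see [root_le]).
   They are arcs (and v_0 is in the first one), so this is their cyclic order
   along the orientation. *)
Definition comps s : seq vertex := enum (fingraph.roots (adj s)).

Definition comp_pos s v : nat := index (fingraph.root (adj s) v) (comps s).

(* The component of v: None for that of v_0, and Some j if it is the one at
   position j.+1, carrying the j-th copy of A. *)
Definition comp_idx s v : option 'I_(ncomp s).-1 :=
  if comp_pos s v is j.+1 then insub j else None.

Definition comp_rep s (j : 'I_(ncomp s).-1) : vertex := nth ord0 (comps s) j.+1.

Lemma adj_csym s : connect_sym (adj s).
Proof. by apply: sym_connect_sym => u v; apply: orbC. Qed.

Lemma size_comps s : size (comps s) = ncomp s.
Proof. by rewrite /comps -cardE; apply: eq_card => v; rewrite !inE ?andbT. Qed.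

Lemma root_le s u v : connect (adj s) u v -> (fingraph.root (adj s) u <= v)%N.
Proof.
move=> uv; rewrite /fingraph.root /pick.
have: v \in enum (connect (adj s) u) by rewrite mem_enum.
have: sorted (fun x y : vertex => x < y)%N (enum (connect (adj s) u)).
  rewrite {1}/enum_mem; apply: sorted_filter => [x y z|]; first exact: ltn_trans.
  by rewrite -enumT; have := iota_ltn_sorted 0 n.+1; rewrite -val_enum_ord sorted_map.
case: (enum _) => [|x l] //= xl; rewrite inE => /predU1P[->//|vl].
have tr : transitive (fun x y : vertex => x < y)%N.
  by move=> ? ? ?; apply: ltn_trans.
by have /allP/(_ v vl) := order_path_min tr xl; apply: ltnW.
Qed.

Lemma comp_pos_lt s v : (comp_pos s v < ncomp s)%N.
Proof.
rewrite -size_comps index_mem mem_enum; exact: (roots_root (adj_csym s)).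
Qed.

Lemma comp_posE s v :
  comp_pos s v = if comp_idx s v is Some j then j.+1 else 0%N.
Proof.
rewrite /comp_idx; have := comp_pos_lt s v; case: (comp_pos s v) => // j lt_j.
by rewrite insubT //; lia.
Qed.

Lemma comp_idxP s u v :
  reflect (comp_idx s u = comp_idx s v) (connect (adj s) u v).
Proof.
apply: (iffP idP) => [/(fingraph.rootP (adj_csym s)) uv|uv].
  by rewrite /comp_idx /comp_pos uv.
apply/(fingraph.rootP (adj_csym s)).
have: comp_pos s u = comp_pos s v by rewrite !comp_posE uv.
move/(congr1 (nth ord0 (comps s))).
by rewrite !nth_index // mem_enum; apply: (roots_root (adj_csym s)).
Qed.

Lemma comp_idx0 s : comp_idx s ord0 = None.
Proof.
suff: comp_pos s ord0 = 0%N by rewrite /comp_idx => ->.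
have r0 : fingraph.root (adj s) ord0 = ord0.
  apply: val_inj => /=; apply/eqP; rewrite -leqn0.
  exact: (root_le (connect0 _ ord0)).
rewrite /comp_pos r0 /comps /enum_mem -enumT enum_ordSl /=.
by rewrite ifT /= ?eqxx //; apply/eqP.
Qed.

Lemma comp_repK s j : comp_idx s (comp_rep j) = Some j.
Proof.
have lt_j : (j.+1 < size (comps s))%N by rewrite size_comps; have := ltn_ord j; lia.
have : comp_pos s (comp_rep j) = j.+1.
  rewrite /comp_pos /comp_rep.
  have /eqP-> : nth ord0 (comps s) j.+1 \in fingraph.roots (adj s).
    by rewrite -mem_enum mem_nth.
  by rewrite index_uniq ?enum_uniq.
by rewrite /comp_idx => ->; rewrite valK.
Qed.

Lemma adj_edge s e : e \in s -> connect (adj s) e (ordS e).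
Proof. by move=> es; apply/connect1/orP; left; apply/andP. Qed.

Lemma connect_sub_edge s s' u v :
  s \subset s' -> connect (adj s) u v -> connect (adj s') u v.
Proof.
move=> /subsetP ss'; apply: connect_sub => {}u {}v uv; apply/connect1/orP.
by case/orP: uv => /andP[/ss' xs xy]; [left | right]; apply/andP.
Qed.

Lemma connect_add_edge s e u v (t := fun w =>
    connect (adj s) w e || connect (adj s) w (ordS e)) :
  connect (adj (e |: s)) u v -> connect (adj s) u v \/ t u /\ t v.
Proof.
case/connectP=> p; elim: p u => [|w p IHp] u /= => [_ ->|/andP[uw /IHp wp /wp{wp}]].
  by left; apply: connect0.
have tr x y : connect (adj s) x y -> t y -> t x.
  by move=> xy /orP[]yz; rewrite /t (connect_trans xy yz) ?orbT.
have te : t e by rewrite /t connect0.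
have tS : t (ordS e) by rewrite /t connect0 orbT.
have [uw'|[tu tw]] : adj s u w \/ t u /\ t w.
  case/orP: uw => /andP[/setU1P[xe|xs] xy].
  - by right; rewrite (eqP xy) xe.
  - by left; apply/orP; left; apply/andP.
  - by right; rewrite (eqP xy) xe.
  by left; apply/orP; right; apply/andP.
- case=> [wv|[tw tv]]; first by left; apply: connect_trans wv; apply: connect1.
  by right; split=> //; apply: tr tw; apply: connect1.
case=> [wv|[_ tv]]; right; split=> //.
by apply: tr tw; rewrite (adj_csym s).
Qed.

End Polygon.

Section GraphComplex.
Variables (k : comPzRingType) (A : algType k) (M : bimodType A) (n : nat).
Local Notation edge := 'I_n.+1.
Implicit Types (s : {set edge}) (e : edge).

Definition Phi s : lmodType k := tensor M A (ncomp s).-1.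

(* The weight attached by a pure tensor to the component p; the value 1 at the
   base component, whose weight is in M, is never used. *)
Definition weight (r : nat) (a : 'I_r -> A) (p : option 'I_r) : A := oapp a 1 p.

(* The weights on s' = e |: s obtained by merging the components joined by e. *)
Definition merge_mod s e (m : M) (a : 'I_(ncomp s).-1 -> A) : M :=
  match comp_idx s e, comp_idx s (ordS e) with
  | None, Some j => ract m (a j)
  | Some i, None => lact (a i) m
  | _, _ => m
  end.

Definition merge_alg s s' e (a : 'I_(ncomp s).-1 -> A) : 'I_(ncomp s').-1 -> A :=
  fun j => let v := comp_rep j in
    if connect (adj s') e v
    then weight a (comp_idx s e) * weight a (comp_idx s (ordS e))
    else weight a (comp_idx s v).

Definition merge s s' e (m : M) (a : 'I_(ncomp s).-1 -> A) : Phi s' :=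
  if comp_idx s e == comp_idx s (ordS e) then 0
  else pure (merge_mod e m a) (merge_alg e a).

Lemma weight_upd r (a : 'I_r -> A) i x : weight (upd a i x) (Some i) = x.
Proof. by rewrite /weight /= /upd eqxx. Qed.

Lemma weight_upd_neq r (a : 'I_r -> A) i x p :
  p != Some i -> weight (upd a i x) p = weight a p.
Proof.
by case: p => [j|] //= ji; rewrite /upd ifN.
Qed.

Fact merge_multilinear s s' e : s' = e |: s -> multilinear (@merge s s' e).
Proof.
move=> def_s'; rewrite /merge.
have [_|pq] := eqVneq (comp_idx s e) (comp_idx s (ordS e)).
  by split=> *; rewrite scaler0 addr0.
have ss' u v : connect (adj s) u v -> connect (adj s') u v.
  by apply: connect_sub_edge; rewrite def_s' subsetUr.
have eS : connect (adj s') e (ordS e) by rewrite adj_edge // def_s' !inE eqxx.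
have sym' : connect_sym (adj s') by apply: adj_csym.
have s's u v : connect (adj s') u v -> ~~ connect (adj s') e v ->
    comp_idx s u = comp_idx s v.
  rewrite def_s' => /connect_add_edge[/comp_idxP//|[_ tv]].
  rewrite -def_s' sym' => /negP[].
  case/orP: tv => /ss' // ve; apply: connect_trans ve _.
  by rewrite sym'.
have s'e v : connect (adj s') e v ->
    comp_idx s v = comp_idx s e \/ comp_idx s v = comp_idx s (ordS e).
  rewrite def_s' => /connect_add_edge[/comp_idxP->|[_ /orP[]/comp_idxP]]; by auto.
have s'Ne v : ~~ connect (adj s') e v ->
    comp_idx s v != comp_idx s e /\ comp_idx s v != comp_idx s (ordS e).
  move=> nev; split; apply: contra nev => /eqP/comp_idxP/ss'; rewrite sym' //.
  exact: connect_trans.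
have rep_eq (j j' : 'I_(ncomp s').-1) v :
    connect (adj s') v (comp_rep j) -> comp_idx s' v = Some j' -> j = j'.
  by move=> /comp_idxP ->; rewrite comp_repK => -[].
have rep_nb (j : 'I_(ncomp s').-1) : ~~ connect (adj s') ord0 (comp_rep j).
  by apply/negP => /comp_idxP; rewrite comp_repK comp_idx0.
apply: (@pure_comp_multilinear _ _ _ _ _ (@merge_mod s e) (@merge_alg s s' e)).
  move=> c m m' a; rewrite /merge_mod.
  by case: (comp_idx s e) (comp_idx s (ordS e)) => [i|] [j|] //;
     [apply: lact_linearr | apply: ract_linearl].
move=> l; have [pl|pl] := eqVneq (comp_idx s e) (Some l).
  case Eq: (comp_idx s (ordS e)) => [l2|].
    right; split=> [x m a|]; first by rewrite /merge_mod pl Eq.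
    have [j Ej] : exists j, comp_idx s' e = Some j.
      case Ee: (comp_idx s' e) => [j|]; first by exists j.
      have /comp_idxP/s'e[] : comp_idx s' e = comp_idx s' ord0 by rewrite comp_idx0.
        by rewrite comp_idx0 pl.
      by rewrite comp_idx0 Eq.
    exists j => a; exists (fun x => x * weight a (Some l2)).
      by move=> c x y; rewrite mulrDl scalerAl.
    move=> x; apply/funext => j'; rewrite /merge_alg [RHS]/upd pl Eq.
    rewrite weight_upd weight_upd_neq -?Eq -?pl 1?eq_sym //.
    have [->|jj'] := eqVneq j' j.
      by rewrite ifT //; apply/comp_idxP; rewrite comp_repK.
    have [/rep_eq/(_ Ej) E|ne] := boolP (connect (adj s') e (comp_rep j')).
      by rewrite E eqxx in jj'.
    by rewrite weight_upd_neq // -pl; case: (s'Ne _ ne).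
  left; split=> [c x y m a|x a].
    by rewrite /merge_mod pl Eq /upd eqxx; apply: lact_linearl.
  apply/funext => j; rewrite /merge_alg; case: ifPn => [ej|/s'Ne[]].
    case/negP: (rep_nb j); apply: connect_trans ej; rewrite sym'.
    by apply: connect_trans eS _; apply/ss'/comp_idxP; rewrite comp_idx0.
  by rewrite pl => ? _; rewrite weight_upd_neq.
have [ql|ql] := eqVneq (comp_idx s (ordS e)) (Some l).
  case Ep: (comp_idx s e) => [l2|].
    right; split=> [x m a|]; first by rewrite /merge_mod ql Ep.
    have [j Ej] : exists j, comp_idx s' e = Some j.
      case Ee: (comp_idx s' e) => [j|]; first by exists j.
      have /comp_idxP/s'e[] : comp_idx s' e = comp_idx s' ord0 by rewrite comp_idx0.
        by rewrite comp_idx0 Ep.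
      by rewrite comp_idx0 ql.
    exists j => a; exists (fun x => weight a (Some l2) * x).
      by move=> c x y; rewrite mulrDr scalerAr.
    move=> x; apply/funext => j'; rewrite /merge_alg [RHS]/upd ql Ep.
    rewrite weight_upd weight_upd_neq -?Ep //.
    have [->|jj'] := eqVneq j' j.
      by rewrite ifT //; apply/comp_idxP; rewrite comp_repK.
    have [/rep_eq/(_ Ej) E|ne] := boolP (connect (adj s') e (comp_rep j')).
      by rewrite E eqxx in jj'.
    by rewrite weight_upd_neq // -ql; case: (s'Ne _ ne).
  left; split=> [c x y m a|x a].
    by rewrite /merge_mod ql Ep /upd eqxx; apply: ract_linearr.
  apply/funext => j; rewrite /merge_alg; case: ifPn => [ej|/s'Ne[]].
    case/negP: (rep_nb j); apply: connect_trans ej; rewrite sym'.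
    by apply/ss'/comp_idxP; rewrite comp_idx0.
  by rewrite ql => _ ?; rewrite weight_upd_neq.
right; split=> [x m a|].
  rewrite /merge_mod; case: (comp_idx s e) (comp_idx s (ordS e)) pl ql => [i|] [j|] //=.
    by move=> il _; rewrite /upd ifN.
  by move=> _ jl; rewrite /upd ifN.
pose u := comp_rep l; have ul : comp_idx s u = Some l by apply: comp_repK.
have eu : ~~ connect (adj s') e u.
  by apply/negP => /s'e[] E; [case/eqP: pl | case/eqP: ql]; rewrite -E.
have [j Ej] : exists j, comp_idx s' u = Some j.
  case Eu: (comp_idx s' u) => [j|]; first by exists j.
  have /comp_idxP/s's/(_ eu) : comp_idx s' ord0 = comp_idx s' u by rewrite comp_idx0.
  by rewrite comp_idx0 ul.
exists j => a; exists id => // x; apply/funext => j'; rewrite /merge_alg [RHS]/upd.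
have [->|jj'] := eqVneq j' j.
  have uj : connect (adj s') (comp_rep j) u by apply/comp_idxP; rewrite comp_repK.
  rewrite (s's _ _ uj eu) ul weight_upd ifN //.
  by apply: contra eu => /connect_trans; apply.
have [_|ej'] := ifPn; first by rewrite !weight_upd_neq.
rewrite weight_upd_neq //; apply: contra jj' => /eqP; rewrite -ul => /comp_idxP/ss'.
by rewrite sym' => /rep_eq/(_ Ej) ->.
Qed.

(* The map Phi (s \subset s') for s' = e |: s. *)
Definition edge_map s s' e (def_s' : s' = e |: s) : {linear Phi s -> Phi s'} :=
  tlift (Multilin (merge_multilinear def_s')).

Definition cochains (i : nat) : lmodType k :=
  dirsum (fun S : {s : {set edge} | #|s| == i} => Phi (val S)).

Section Differential.
Variable leE : rel edge.

Definition edge_sign s e : nat := #|[set f in s | leE f e && (f != e)]|.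

Fact card_rem_edge i s e : #|s| == i.+1 -> e \in s -> #|s :\ e| == i.
Proof. by move=> + es; rewrite (cardsD1 e) es. Qed.

(* The component of d x at S is the sum of the contributions of the
   x (S :\ e), for e in S. *)
Definition cobd_fun i (x : cochains i) : cochains i.+1 := fun S =>
  \sum_(e : {e | e \in val S})
    (-1) ^+ edge_sign (val S :\ val e) (val e) *:
    edge_map (esym (setD1K (valP e)))
      (x (exist _ (val S :\ val e) (card_rem_edge (valP S) (valP e)))).

Fact cobd_linear i : linear (@cobd_fun i).
Proof.
move=> c x y; apply/functional_extensionality_dep => S.
transitivity (c *: cobd_fun x S + cobd_fun y S); last by [].
rewrite /cobd_fun scaler_sumr -big_split; apply: eq_bigr => e _ /=.
set S' := exist _ _ _; have -> : (c *: x + y) S' = c *: x S' + y S' by [].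
by rewrite linearP scalerDr !scalerA mulrC.
Qed.

HB.instance Definition _ i := GRing.isLinear.Build k (cochains i)
  (cochains i.+1) *:%R (@cobd_fun i) (@cobd_linear i).

Definition cobd i : {linear cochains i -> cochains i.+1} := @cobd_fun i.

(* The cohomology of the complex for the ordering leE of the edges *)
Definition graph_coh (i : nat) : lmodType k :=
  match i with
  | 0 => homology (\0 : {linear cochains 0 -> cochains 0}) (cobd 0)
  | j.+1 => homology (cobd j) (cobd j.+1)
  end.

End Differential.

End GraphComplex.

Section Gradings.
Variable k : comPzRingType.

(* V is the internal direct sum of the gr j. *)
Definition is_grading (V : lmodType k) (gr : int -> submodClosed V) : Prop :=
  (forall x, exists (js : seq int) (y : int -> V),
     (forall j, y j \in gr j) /\ x = \sum_(j <- js) y j) /\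
  (forall (js : seq int) (y : int -> V), uniq js -> (forall j, y j \in gr j) ->
     \sum_(j <- js) y j = 0 -> forall j, j \in js -> y j = 0).

Variables (A : algType k) (M : bimodType A).

Definition graded_algebra (grA : int -> submodClosed A) : Prop :=
  [/\ is_grading grA, 1 \in grA 0 &
      forall i j a b, a \in grA i -> b \in grA j -> a * b \in grA (i + j)].

Definition graded_bimodule (grA : int -> submodClosed A)
    (grM : int -> submodClosed M) : Prop :=
  [/\ is_grading grM,
      forall i j a m, a \in grA i -> m \in grM j -> lact a m \in grM (i + j) &
      forall i j m a, m \in grM i -> a \in grA j -> ract m a \in grM (i + j)].

Variables (grA : int -> submodClosed A) (grM : int -> submodClosed M).

Variant pure_of_deg r (j : int) : tensor M A r -> Prop :=
  PureOfDeg (d0 : int) (d : 'I_r -> int) (m : M) (a : 'I_r -> A) of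
    m \in grM d0 & (forall i, a i \in grA (d i)) & d0 + \sum_i d i = j :
    pure_of_deg j (pure m a).

Definition tensor_deg r (j : int) : submodClosed (tensor M A r) :=
  lspan (@pure_of_deg r j).

Definition HH_deg (r : nat) (j : int) : lmodType k :=
  homology_on (tensor_deg r.+1 j) (tensor_deg r j)
    (hboundary M r.+1) (hboundary M r).

Variables (n : nat) (leE : rel 'I_n.+1).

Definition cochains_deg (i : nat) (j : int) : submodClosed (cochains M n i) :=
  dirsum_pred (fun S : {s : {set 'I_n.+1} | #|s| == i} =>
                 tensor_deg (ncomp (val S)).-1 j).

Definition graph_coh_deg (i : nat) (j : int) : lmodType k :=
  match i with
  | 0 => homology_on (cochains_deg 0 j) (cochains_deg 0 j)
           (\0 : {linear cochains M n 0 -> cochains M n 0}) (cobd M leE 0)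
  | i'.+1 => homology_on (cochains_deg i' j) (cochains_deg i'.+1 j)
               (cobd M leE i') (cobd M leE i'.+1)
  end.

End Gradings.

(* Main.v *)
Require Import Defs.
From HB Require Import structures.
From mathcomp Require Import all_boot all_order all_algebra.
From mathcomp Require Import boolp zify.

(* Let X_r = M (x) A^(x) r be the simplicial module whose face maps are the
   Hochschild faces and whose degeneracies insert the unit of A. Indexing the
   summand of s by the set T of missing edges turns the graph complex, up to
   signs, into the complex D with one copy of X_r for each T of cardinal r + 1,
   in which removing from T its p-th element acts as the p-th face: the missing
   edges cut the polygon into arcs, and adding an edge merges two consecutive
   ones. Summing over T is a chain map from D to the Hochschild complex.

   With the degeneracies every cycle of D in degree r < n can be moved to the
   single set T = {0, ..., r}; it is then an element of X_r all of whose faces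
   vanish. On the other side, Moore normalisation replaces a Hochschild cycle by
   one all of whose faces vanish, and a chain bounding such an element by one
   whose faces but the last vanish; such elements, placed on an initial segment,
   are cycles, resp. bounding chains, of D. All these operations preserve
   internal degrees. *)

Set Implicit Arguments.
Unset Strict Implicit.
Unset Printing Implicit Defensive.

Import GRing.Theory.
Local Open Scope ring_scope.

Lemma submodB (k : comPzRingType) (V : lmodType k) (S : submodClosed V) x y :
  x \in S -> y \in S -> x - y \in S.
Proof. by move=> Sx Sy; rewrite -scaleN1r rpredD // rpredZ. Qed.

Lemma signZK (k : comPzRingType) (V : lmodType k) i :
  involutive ( *:%R ((-1) ^+ i) : V -> V).
Proof. by move=> v; rewrite scalerA -expr2 sqrr_sign scale1r. Qed.

(** * Positions in a set of edges *)

Section Counting.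
Variable n : nat.
Implicit Types (S T : {set 'I_n.+1}) (e f : 'I_n.+1) (v w m : nat).

(** For [e] in [T], [cnt T e] is the rank of [e] in [T], starting from 0. The bound is a natural
    number, so that [n.+1] is allowed and inductions can run over initial segments of the edges. *)
Definition cnt T v : nat := #|[set f in T | (f < v)%N]|.

Lemma cntU1 T e v : e \notin T -> cnt (e |: T) v = ((e < v) + cnt T v)%N.
Proof.
move=> eT; rewrite /cnt; have [ev|ve] := ltnP e v.
  rewrite (_ : [set f in e |: T | _] = e |: [set f in T | (f < v)%N]).
    by rewrite cardsU1 inE (negPf eT).
  by apply/setP => f; rewrite !inE; case: eqVneq => // ->; rewrite ev.
congr #|pred_of_set _|; apply/setP => f; rewrite !inE.
by case: eqVneq => // ->; rewrite ltnNge ve /= andbF.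
Qed.

Lemma cnt_setU1 T e : cnt (e |: T) e = cnt T e.
Proof.
by congr #|pred_of_set _|; apply/setP => f; rewrite !inE; case: eqVneq => // ->;
  rewrite ltnn !andbF.
Qed.

Lemma cnt_setD1 T e : cnt (T :\ e) e = cnt T e.
Proof.
by congr #|pred_of_set _|; apply/setP => f; rewrite !inE; case: eqVneq => // ->;
  rewrite ltnn !andbF.
Qed.

Lemma leq_cnt T v w : (v <= w)%N -> (cnt T v <= cnt T w)%N.
Proof.
move=> vw; apply/subset_leq_card/subsetP => f; rewrite !inE => /andP[-> /=].
by move=> /leq_trans; apply.
Qed.

Lemma cnt_max T : cnt T n.+1 = #|T|.
Proof. by congr #|pred_of_set _|; apply/setP => f; rewrite !inE ltn_ord andbT. Qed.

Lemma cnt_leq_card T v : (cnt T v <= #|T|)%N.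
Proof. by apply/subset_leq_card/subsetP => f; rewrite inE => /andP[]. Qed.

Lemma cnt0 T : cnt T 0 = 0%N.
Proof. by apply: eq_card0 => f; rewrite inE ltn0 andbF. Qed.

Lemma cntS T e : cnt T e.+1 = (cnt T e + (e \in T))%N.
Proof.
have [eT|eT] := boolP (e \in T); last first.
  rewrite addn0; congr #|pred_of_set _|; apply/setP => f; rewrite !inE ltnS leq_eqVlt.
  by case: (eqVneq f e) => [->|]; rewrite ?(negPf eT) ?(val_eqE f e) => // /negPf->.
rewrite -[in LHS](setD1K eT) cntU1 ?setD11 // ltnSn addnC -cnt_setD1.
congr (_ + _)%N; congr #|pred_of_set _|; apply/setP => f; rewrite !inE ltnS leq_eqVlt.
by case: (eqVneq f e) => //= fe; rewrite (val_eqE f e) (negPf fe).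
Qed.

Lemma cnt_lt T e v : e \in T -> (e < v)%N -> (cnt T e < cnt T v)%N.
Proof. by move=> eT /(leq_cnt T); rewrite cntS eT addn1. Qed.

Lemma cnt_lt_card T e : e \in T -> (cnt T e < #|T|)%N.
Proof. by move=> eT; rewrite -cnt_max cnt_lt. Qed.

Lemma cnt_surj T j : (j < #|T|)%N -> exists2 e, e \in T & cnt T e = j.
Proof.
rewrite -cnt_max; move: (leqnn n.+1); move: {1 3}n.+1 => m.
elim: m => [|m IHm] mn; first by rewrite cnt0.
have := cntS T (Ordinal mn) => /= ->; have [mT|_] := boolP (_ \in T); last first.
  by rewrite addn0; apply: IHm; apply: ltnW.
rewrite addn1 ltnS leq_eqVlt => /predU1P[->|]; last by apply: IHm; apply: ltnW.
by exists (Ordinal mn).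
Qed.

(** On [T] the function [cnt T] is a bijection onto the ranks below [#|T|]; the induction cuts [T]
    at a bound [m]. *)
Lemma sum_cnt (V : zmodType) T (F : nat -> V) :
  \sum_(e in T) F (cnt T e) = \sum_(i < #|T|) F i.
Proof.
transitivity (\sum_(e in T | (e < n.+1)%N) F (cnt T e)).
  by apply: eq_bigl => e; rewrite ltn_ord andbT.
rewrite -(cnt_max T); suff gen m : (m <= n.+1)%N ->
    \sum_(e in T | (e < m)%N) F (cnt T e) = \sum_(i < cnt T m) F i by exact: gen.
elim: m => [|m IHm] mn.
  by rewrite cnt0 big_ord0 big_pred0 // => e; rewrite ltn0 andbF.
have := cntS T (Ordinal mn) => /= ->; have [mT|mT] := boolP (_ \in T).
  rewrite addn1 big_ord_recr /= -IHm ?(ltnW mn) // (bigD1 (Ordinal mn)) /=; last first.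
    by rewrite mT ltnSn.
  rewrite addrC; congr (_ + _); apply: eq_bigl => e; rewrite -val_eqE /= -andbA.
  by congr (_ && _); lia.
rewrite addn0 -IHm ?(ltnW mn) //; apply: eq_bigl => e; rewrite ltnS leq_eqVlt.
case: (boolP (e \in T)) => //= eT; case: eqP => //= em.
by case/negP: mT; rewrite (_ : Ordinal mn = e) //; apply: val_inj.
Qed.

End Counting.

(** Exchanging the indices in the half [f < e] of the sum makes it cancel the half [e < f]: the
    usual reason why a differential squares to zero. *)
Lemma sum_antisym n (V : zmodType) (Q : pred 'I_n) (G : 'I_n -> 'I_n -> V) :
    (forall e f, Q e -> Q f -> (e < f)%N -> G f e = - G e f) ->
  \sum_(e | Q e) \sum_(f | Q f && (f != e)) G e f = 0.
Proof.
move=> GN; under eq_bigr => e _.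
  rewrite (bigID (fun f : 'I_n => (e < f)%N)) /=.
  over.
rewrite big_split /= addrC [X in X + _](exchange_big_dep Q) /=; last first.
  by move=> e f _ /andP[/andP[]].
rewrite -big_split big1 //= => e Qe.
rewrite [X in _ + X](eq_bigl (fun f => Q f && (e < f)%N)).
  rewrite [X in X + _](eq_bigl (fun f => Q f && (e < f)%N)).
    by rewrite -big_split big1 //= => f /andP[Qf ef]; rewrite GN ?addNr.
  by move=> f /=; rewrite Qe -(val_eqE e f) /=; lia.
by move=> f /=; rewrite -(val_eqE f e) /=; lia.
Qed.

(** * Moore normalisation and the complex D *)

Section Moore.
Variables (k : comPzRingType) (X : nat -> lmodType k).
Variable d : forall r, nat -> {linear X r -> X r.-1}.
Variable s : forall r, nat -> {linear X r -> X r.+1}.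
(** To be taken as the whole module or as the part of a given internal degree: carrying [P] along
    treats the ungraded and the graded statements together. *)
Variable P : forall r, submodClosed (X r).
(** Since [0.-1 = 0], [d 0] maps [X 0] to itself and must vanish for [bd] to be the boundary. *)
Hypothesis face0 : forall i x, d 0 i x = 0.
Hypothesis face_face : forall r i j x, (i < j <= r.+2)%N ->
  d r.+1 i (d r.+2 j x) = d r.+1 j.-1 (d r.+2 i x).
Hypothesis face_degen_lt : forall r i j x, (i < j <= r.+1)%N ->
  d r.+2 i (s r.+1 j x) = s r j.-1 (d r.+1 i x).
Hypothesis face_degen_id : forall r j x, (j <= r)%N -> d r.+1 j (s r j x) = x.
Hypothesis face_degen_idS : forall r j x,
  (j <= r)%N -> d r.+1 j.+1 (s r j x) = x.
Hypothesis face_degen_gt : forall r i j x, (j.+1 < i <= r.+2)%N ->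
  d r.+2 i (s r.+1 j x) = s r j (d r.+1 i.-1 x).
Hypothesis face_P : forall r i x,
  (i <= r)%N -> x \in P r -> d r i x \in P r.-1.
Hypothesis degen_P : forall r i x,
  (i <= r)%N -> x \in P r -> s r i x \in P r.+1.

Definition bd r (x : X r) : X r.-1 := \sum_(i < r.+1) (-1) ^+ i *: d r i x.

(** Filtration leading to the Moore complex: for [q = r], only the last face may be nonzero. *)
Definition moore q r (x : X r) := forall j, (j < q)%N -> d r j x = 0.

Fact bd_linear r : linear (@bd r).
Proof.
move=> c x y; rewrite /bd scaler_sumr -big_split; apply: eq_bigr => i _ /=.
by rewrite linearP scalerDr !scalerA mulrC.
Qed.

HB.instance Definition _ r := GRing.isLinear.Build k (X r) (X r.-1) *:%R
  (@bd r) (@bd_linear r).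

Lemma moore_last r (x : X r.+1) :
  moore r.+1 x -> bd x = (-1) ^+ r.+1 *: d r.+1 r.+1 x.
Proof.
move=> mx; rewrite /bd big_ord_recr /= big1 ?add0r // => i _.
by rewrite mx ?scaler0.
Qed.

(** The correction has the same [q]-th face as [x], because [d_q s_q = id]; its earlier faces factor
    through the [d_j x] with [j < q], which are zero. *)
Lemma moore_step q r (x : X r.+1) : (q <= r)%N -> moore q x ->
  moore q.+1 (x - s r q (d r.+1 q x)).
Proof.
move=> qr mx j; rewrite ltnS leq_eqVlt linearB /= => /predU1P[->|jq].
  by rewrite face_degen_id ?subrr.
case: r x qr mx => [|r] x qr mx; first by lia.
rewrite (mx j) // face_degen_lt; last by lia.
by rewrite face_face ?(mx j) ?linear0 ?linear0 ?addr0 //; lia.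
Qed.

(** In fact [bd (s_q d_q x) = s_q d_q (bd x)]. On both sides the terms [q] and [q.+1] cancel and the
    earlier ones vanish; the later ones agree by the simplicial identities. *)
Lemma bd_degen_face q r (x : X r.+1) : (q <= r)%N -> moore q x ->
  d r q (bd x) = 0 -> bd (s r q (d r.+1 q x)) = 0.
Proof.
set u := d r.+1 q x; move=> qr mx dq.
have sign_cancel (v : X r) : (-1) ^+ q *: v + (-1) ^+ q.+1 *: v = 0.
  by rewrite exprS mulN1r scaleNr subrr.
have [q1 q2] : (q < r.+2)%N /\ (q.+1 < r.+2)%N by lia.
pose iq := Ordinal q1; pose iq1 := Ordinal q2.
have iqq1 : iq1 != iq by rewrite -val_eqE /=; lia.
(* Two equal consecutive terms cancel. This applies on the left because [d_q s_q = d_(q+1) s_q], and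
   on the right because [d_q d_(q+1) = d_q d_q]. *)
have split_sum (F : nat -> X r) v : F q = v -> F q.+1 = v ->
    \sum_(i < r.+2) (-1) ^+ i *: F i =
    \sum_(i < r.+2 | (i != iq) && (i != iq1)) (-1) ^+ i *: F i.
  move=> Fq Fq1; rewrite (bigD1 iq) //= (bigD1 iq1) //= addrA Fq Fq1.
  by rewrite sign_cancel add0r.
rewrite /bd (split_sum (fun i => d r.+1 i (s r q u)) u); last first.
- by rewrite face_degen_idS.
- by rewrite face_degen_id.
case: r x @u qr mx dq sign_cancel q1 q2 @iq @iq1 iqq1 split_sum =>
    [|r] x u qr mx dq sign_cancel q1 q2 iq iq1 iqq1 split_sum.
  by rewrite big1 // => -[[|[|i]] lt_i] //; rewrite -!val_eqE /=; lia.
pose G i := s r q (d r.+1 q (d r.+2 i x)).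
transitivity (\sum_(i < r.+3) (-1) ^+ i *: G i); last first.
  transitivity (s r q (d r.+1 q (bd x))); last by rewrite dq linear0.
  rewrite !linear_sum; apply: eq_bigr => i _; by rewrite !linearZ.
rewrite [RHS](split_sum _ (G q)) //; last by rewrite /G face_face //; lia.
apply: eq_bigr => i; rewrite -!val_eqE /= => /andP[iq_ iq1_].
congr (_ *: _); case: (ltnP i q) => iq'.
  rewrite /G (mx i) // !linear0 face_degen_lt; last by lia.
  by rewrite /u face_face ?(mx i) ?linear0 ?linear0 //; lia.
have lt_i := ltn_ord i.
rewrite face_degen_gt; last by lia.
by rewrite /G [in RHS]face_face //; lia.
Qed.

(** Makes the correction of [moore_step] a boundary: since [bd x = 0], the faces of [x] beyond [q]
    sum to minus its [q]-th term. *)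
Lemma bd_degen q r (x : X r.+1) : (q <= r)%N -> moore q x -> bd x = 0 ->
  bd ((-1) ^+ q *: s r.+1 q x) = s r q (d r.+1 q x).
Proof.
move=> qr mx bx.
pose F i := if (q < i)%N then (-1) ^+ i *: s r q (d r.+1 i x) else 0.
have sumF : \sum_(i < r.+2) F i = - ((-1) ^+ q *: s r q (d r.+1 q x)).
  have := congr1 (s r q) bx; rewrite linear0 linear_sum.
  have q1 : (q < r.+2)%N by lia.
  rewrite (bigD1 (Ordinal q1)) //= linearZ /= => /(canRL (addKr _)).
  rewrite addr0 => <-; rewrite (bigD1 (Ordinal q1)) //= /F ltnn add0r.
  apply: eq_bigr => i; rewrite -val_eqE /= => iq; rewrite linearZ /=.
  by case: ltnP => // qi; rewrite mx ?linear0 ?scaler0 //; lia.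
rewrite /bd; under eq_bigr do rewrite linearZ.
(* [Fx] selects the indices [q] and [q.+1], where the face undoes the degeneracy and gives [x] with
   opposite signs. A later index [j.+1] gives [- F j], the sign coming from the shift. *)
pose Fx i := (i == q)%:R + (i == q.+1)%:R : k.
transitivity (\sum_(i < r.+3) ((-1) ^+ i * (-1) ^+ q * Fx i) *: x +
    (-1) ^+ q *: \sum_(i < r.+3) (if (i : nat) is j.+1 then - F j else 0)).
  rewrite scaler_sumr -big_split /=; apply: eq_bigr => i _.
  have lt_i := ltn_ord i; rewrite /= scalerA /Fx.
  case: (ltngtP i q) => [iq|iq|->] /=.
  - rewrite face_degen_lt ?mx ?linear0; try lia.
    have -> : (i == q.+1 :> nat) = false by lia.
    rewrite !addr0 !mulr0 scale0r add0r.
    case: (nat_of_ord i) iq => [|j] iq; first by rewrite scaler0.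
    by rewrite /F ifF ?oppr0 ?scaler0 //; lia.
  - have [->|iq1] := eqVneq (i : nat) q.+1.
      rewrite face_degen_idS ?add0r ?mulr1; last by lia.
      by rewrite /F ltnn oppr0 scaler0 addr0.
    rewrite face_degen_gt; last by lia.
    rewrite addr0 mulr0 scale0r add0r.
    case: (nat_of_ord i) iq iq1 lt_i => // j iq iq1 lt_i.
    rewrite /F ifT /=; last by lia.
    rewrite -scaleNr scalerA exprS; congr (_ *: _).
    by rewrite mulN1r mulNr mulrN mulrC.
  - rewrite face_degen_id; last by lia.
    have -> : (q == q.+1 :> nat) = false by lia.
    rewrite addr0 mulr1 (_ : (if q is j.+1 then - F j else 0) = 0).
      by rewrite scaler0 addr0.
    by rewrite /F; case: (q) => // j; rewrite ifF ?oppr0 //; lia.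
rewrite -scaler_suml [X in _ + _ *: X]big_ord_recl /= add0r sumrN sumF opprK scalerA.
rewrite -expr2 sqrr_sign scale1r.
suff -> : \sum_(i < r.+3) (-1) ^+ i * (-1) ^+ q * Fx i = 0 by rewrite scale0r add0r.
have q1 : (q < r.+3)%N by lia.
have q2 : (q.+1 < r.+3)%N by lia.
rewrite (bigD1 (Ordinal q1)) //= (bigD1 (Ordinal q2)) /=; last first.
  by rewrite -val_eqE /=; lia.
rewrite big1 => [|i]; last first.
  rewrite -!val_eqE /Fx /= => /andP[/negPf-> /negPf->].
  by rewrite addr0 mulr0.
rewrite /Fx !eqxx (_ : q == q.+1 = false); last by lia.
rewrite (_ : q.+1 == q = false); last by lia.
by rewrite !addr0 add0r !mulr1 exprS mulN1r mulNr subrr.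
Qed.

(** [moore_step] kills the faces one by one, changing the cycle by the boundaries of [bd_degen].
    When only the last face remains, the boundary is that face up to sign, so it is zero as well. *)
Lemma cycle_moore r (x : X r) : x \in P r -> bd x = 0 ->
  exists y w, [/\ y \in P r, w \in P r.+1, x - y = bd w &
    forall j, (j <= r)%N -> d r j y = 0].
Proof.
case: r x => [|r] x Px bx.
  exists x, 0; rewrite !rpred0 linear0 subrr; split=> // j _; exact: face0.
suff [y [w [Py Pw yw my by_]]] : exists y w, [/\ y \in P r.+1, w \in P r.+2,
    x - y = bd w, moore r.+1 y & bd y = 0].
  exists y, w; split=> // j; rewrite leq_eqVlt => /predU1P[->|/my//].
  have := by_; rewrite (moore_last my) => /(congr1 ( *:%R ((-1) ^+ r.+1))).
  by rewrite scaler0 signZK.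
suff gen q : (q <= r.+1)%N -> exists y w, [/\ y \in P r.+1,
    w \in P r.+2, x - y = bd w, moore q y & bd y = 0] by exact: gen.
elim: q => [|q IHq] qr.
  exists x, 0; rewrite !rpred0 linear0 subrr; split=> //.
have [|y [w [Py Pw yw my by_]]] := IHq; first by lia.
exists (y - s r q (d r.+1 q y)), (w + (-1) ^+ q *: s r.+1 q y); split.
- apply: submodB => //; apply: degen_P; [lia | apply: (@face_P r.+1) => //; lia].
- by rewrite rpredD // rpredZ // degen_P //; lia.
- rewrite [bd _]linearD /= -yw bd_degen //.
  by rewrite opprB addrCA addrC.
- by apply: moore_step => //; lia.
- by rewrite linearB /= by_ bd_degen_face ?subr0 // by_ linear0.
Qed.

(** Same corrections as for cycles: as the faces of [bd w] vanish, each correction is itself a cycle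
    by [bd_degen_face], and the boundary does not change. *)
Lemma boundary_moore r (w : X r.+1) : w \in P r.+1 ->
    (forall j, (j <= r)%N -> d r j (bd w) = 0) ->
  exists w', [/\ w' \in P r.+1, bd w' = bd w & moore r.+1 w'].
Proof.
move=> Pw bw.
suff gen q : (q <= r.+1)%N ->
    exists w', [/\ w' \in P r.+1, bd w' = bd w & moore q w'] by exact: gen.
elim: q => [|q IHq] qr; first by exists w.
have [|w' [Pw' bw' mw']] := IHq; first by lia.
exists (w' - s r q (d r.+1 q w')); split.
- apply: submodB => //; apply: degen_P; [lia | apply: (@face_P r.+1) => //; lia].
- by rewrite linearB /= bd_degen_face ?subr0 // bw' bw.
- by apply: moore_step.
Qed.

(* The alternating sum of the last degeneracies is a section of the t-th face
   killed by the later ones, on the elements killed by the faces t, ..., r-1. *)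
Definition alt_degen t r (x : X r) : X r.+1 :=
  \sum_(i < r.+1 | (t <= i)%N) (-1) ^+ (i - t) *: s r i x.

Lemma alt_degen_P t r (x : X r) : x \in P r -> alt_degen t x \in P r.+1.
Proof.
by move=> Px; apply: rpred_sum => i _; rewrite rpredZ // degen_P // -ltnS.
Qed.

Lemma face_alt_degen t r (x : X r) j : (t <= j <= r)%N ->
    (forall i, (t <= i < r)%N -> d r i x = 0) ->
  d r.+1 j (alt_degen t x) = if j == t then x else 0.
Proof.
(* Only [s_j] and [s_(j-1)] survive under [d_j]; the other degeneracies produce a face of [x] that
   vanishes. The two coefficients are opposite, and for [j = t] the index [j - 1] is outside the
   sum. *)
move=> tjr dx; have face_degen (i : 'I_r.+1) : (t <= i)%N ->
    d r.+1 j (s r i x) = ((i == j :> nat)%:R + (i.+1 == j :> nat)%:R) *: x.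
  move=> ti; have lt_i := ltn_ord i; case: (ltngtP i j) => [ij|ij|ij] /=.
  - have [<-|ij1] := eqVneq i.+1 j; first by rewrite face_degen_idS ?add0r ?scale1r.
    case: r x tjr dx i ti lt_i ij ij1 => [|r] x tjr dx i ti lt_i ij ij1; first by lia.
    by rewrite face_degen_gt ?dx ?linear0 ?addr0 ?scale0r //; lia.
  - rewrite (_ : i.+1 == j = false) ?addr0 ?scale0r; last by lia.
    case: r x tjr dx i ti lt_i ij => [|r] x tjr dx i ti lt_i ij; first by lia.
    by rewrite face_degen_lt ?dx ?linear0 //; lia.
  - rewrite -ij (_ : i.+1 == i = false) ?addr0 ?scale1r; last by lia.
    by rewrite face_degen_id.
rewrite linear_sum; under eq_bigr => i ti do rewrite linearZ /= face_degen // scalerA.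
rewrite -scaler_suml -[RHS](_ : (j == t)%:R *: x = _); last first.
  by case: eqP => _; rewrite ?scale1r ?scale0r.
congr (_ *: _); clear -tjr; have lt_j : (j < r.+1)%N by lia.
rewrite (bigD1 (Ordinal lt_j)) /=; last by lia.
have neqS m : (m.+1 == m) = false by lia.
rewrite eqxx neqS addr0 mulr1; have [jt|jt] := eqVneq j t.
  have -> : (j - t = 0)%N by lia.
  rewrite big1 ?addr0 ?expr0 // => i /andP[ti]; rewrite -val_eqE /= => /negPf->.
  have -> : (i.+1 == j) = false by lia.
  by rewrite addr0 mulr0.
have lt_j1 : (j.-1 < r.+1)%N by lia.
rewrite (bigD1 (Ordinal lt_j1)) /=; last by rewrite -val_eqE /=; lia.
rewrite big1 => [|i]; last first.
  rewrite -!val_eqE /= => /andP[/andP[ti /negPf->] ij].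
  have -> : (i.+1 == j) = false by lia.
  by rewrite addr0 mulr0.
have -> : (j.-1 == j) = false by lia.
have -> : (j.-1.+1 == j) by lia.
have -> : (j - t = (j.-1 - t).+1)%N by lia.
by rewrite exprS mulN1r addr0 add0r mulr1 addNr.
Qed.

(** * The complex D on sets of missing edges *)

Variable n : nat.
Local Notation edges := {set 'I_n.+1}.
Implicit Types (S T U : edges) (e f c : 'I_n.+1).

(** A chain of degree [r] is a family on all sets, of which only the values on sets of cardinal
    [r.+1] count. The number [cnt S e] is the rank of [e] in [e |: S]. *)
Definition bdD r (z : edges -> X r) (S : edges) : X r.-1 :=
  \sum_(e | e \notin S) (-1) ^+ cnt S e *: d r (cnt S e) (z (e |: S)).

Lemma eq_bdD r (z z' : edges -> X r) S : #|S| = r ->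
  (forall T, #|T| = r.+1 -> z T = z' T) -> bdD z S = bdD z' S.
Proof.
by move=> cS zz'; apply: eq_bigr => e eS; rewrite zz' // cardsU1 eS cS.
Qed.

Lemma bdDB r (z z' : edges -> X r) S :
  bdD (fun T => z T - z' T) S = bdD z S - bdD z' S.
Proof.
by rewrite /bdD -sumrB; apply: eq_bigr => e _; rewrite linearB scalerBr.
Qed.

Lemma bdDD r (z z' : edges -> X r) S :
  bdD (fun T => z T + z' T) S = bdD z S + bdD z' S.
Proof.
by rewrite /bdD -big_split; apply: eq_bigr => e _; rewrite linearD scalerDr.
Qed.

(** Adding two edges in either order gives the same composite, by [face_face], with opposite signs,
    since the smaller edge shifts the rank of the larger one. *)
Lemma bdD_bdD r (z : edges -> X r.+2) S :
  #|S| = r.+1 -> bdD (bdD z) S = 0.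
Proof.
move=> cS; rewrite /bdD.
pose G e f := (-1) ^+ (cnt S e + cnt (e |: S) f) *:
  (d r.+1 (cnt S e) (d r.+2 (cnt (e |: S) f) (z (f |: (e |: S)))) : X r).
transitivity (\sum_(e | e \notin S) \sum_(f | (f \notin S) && (f != e)) G e f).
  apply: eq_bigr => e eS; rewrite linear_sum scaler_sumr; apply: eq_big => f.
    by rewrite !inE negb_or andbC.
  by rewrite linearZ scalerA -exprD.
apply: sum_antisym => e f eS fS ef; rewrite /G setUCA !cntU1 // ef.
rewrite ltnNge (ltnW ef) /= add0n add1n addnS exprS mulN1r scaleNr opprK addnC.
congr (_ *: _); have lt_f := cnt_leq_card S f; have le_ef := leq_cnt S (ltnW ef).
by rewrite [RHS]face_face //; lia.
Qed.

Definition cycleD r (z : edges -> X r) := forall S, #|S| = r -> bdD z S = 0.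

Definition inP r (z : edges -> X r) := forall T, #|T| = r.+1 -> z T \in P r.

Lemma bdD_P r (z : edges -> X r) S : inP z -> #|S| = r -> bdD z S \in P r.-1.
Proof.
move=> Pz cS; apply: rpred_sum => e eS; rewrite rpredZ // face_P //.
  by rewrite -cS cnt_leq_card.
by apply: Pz; rewrite cardsU1 eS cS.
Qed.

Lemma cycle_bdD r (u : edges -> X r.+1) : cycleD (bdD u).
Proof.
case: r u => [|r] u S cS; last exact: bdD_bdD.
by rewrite /bdD big1 // => e _; rewrite face0 scaler0.
Qed.

Lemma cycleDB r (z z' : edges -> X r) :
  cycleD z -> cycleD z' -> cycleD (fun T => z T - z' T).
Proof. by move=> cz cz' S cS; rewrite bdDB cz // cz' // subrr. Qed.

Definition all_le (M : nat) T := [forall e in T, (e <= M)%N].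

(* The components of a cycle are eliminated by decreasing largest element M;
   for a given M, they are pushed to sets with longer and longer runs ending at
   M, until these runs have more than r + 1 elements. *)
Definition top_run (M : 'I_n.+1) p T := all_le M T &&
  ((M \in T) ==> [forall e : 'I_n.+1, (M < e + p)%N && (e <= M)%N ==> (e \in T)]).

Lemma top_runP (M : 'I_n.+1) p T :
  reflect ((forall e, e \in T -> (e <= M)%N) /\
           (M \in T -> forall e, (M < e + p)%N -> (e <= M)%N -> e \in T))
          (top_run M p T).
Proof.
apply: (iffP andP) => [[/forall_inP le_T /implyP run]|[le_T run]]; split=> //.
- by move=> /run/forallP eT e Me eM; move: (eT e); rewrite Me eM.
- exact/forall_inP.
by apply/implyP => MT; apply/forallP => e; apply/implyP => /andP[]; apply: run.
Qed.

(** The ranks [j] considered are those of the edges of the run after [c], except [M], which has rank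
    [r]. If [e] is the edge of rank [j], the cycle condition at [T :\ e] reduces to this single
    face. *)
Lemma top_run_face r (z : edges -> X r) (M c : 'I_n.+1) p T j :
    (c + p = M)%N -> cycleD z ->
    (forall T, #|T| = r.+1 -> ~~ top_run M p T -> z T = 0) ->
    #|T| = r.+1 -> c \notin T -> (forall e, e \in T -> (e <= M)%N) ->
    (forall e, (c < e <= M)%N -> e \in T) ->
  (cnt T c <= j < r)%N -> d r j (z T) = 0.
Proof.
move=> cpM cz run_z cT ncT le_T run_T /andP[cj jr].
have [|e eT ej] := @cnt_surj _ T j; first by lia.
have ce : (c < e)%N.
  rewrite ltnNge leq_eqVlt; apply/negP => /predU1P[/val_inj ec|ec].
    by rewrite -ec eT in ncT.
  by have := cnt_lt eT ec; lia.
have eM : e != M.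
  apply/eqP => eM; have MT : M \in T by rewrite -eM.
  suff: cnt T M = r by rewrite -eM; lia.
  have := cntS T M; rewrite MT addn1 => cM; apply: succn_inj; rewrite -cM -cT.
  congr #|pred_of_set _|; apply/setP => f; rewrite !inE ltnS.
  by case: (boolP (f \in T)) => //= /le_T.
have MT : M \in T by apply: run_T; rewrite leqnn andbT; apply: leq_trans ce (le_T e eT).
have := cz (T :\ e) _; rewrite /bdD (bigD1 e) ?setD11 //= big1 => [|f].
  rewrite addr0 cnt_setD1 setD1K // ej => /(_ _)/(congr1 ( *:%R ((-1) ^+ j))).
  rewrite scaler0 signZK; apply.
  by move: cT; rewrite (cardsD1 e) eT => -[].
(* Any other set [f |: (T :\ e)] contains [M] but lacks [e], so its run is broken and [z] vanishes
   there. *)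
move=> /andP[fT fe]; rewrite run_z ?linear0 ?scaler0 //.
  by rewrite cardsU1 fT -cT [in RHS](cardsD1 e) eT.
apply/negP => /top_runP[_ /(_ _ e)]; rewrite !inE eqxx orbF (eq_sym e f) (negPf fe).
rewrite (eq_sym M e) eM MT orbT => /(_ isT) H; suff: false by [].
by apply: H; [rewrite -cpM ltn_add2r|exact: le_T].
Qed.

(** The sets to clear have a run of exactly [p.+1] edges ending at [M]. Adding the edge [c] just
    before the run and applying [alt_degen] at the rank of [c] gives a chain whose boundary has the
    component [z T] there. *)
Lemma top_run_step r (z : edges -> X r) (M : 'I_n.+1) p : (p < M)%N ->
    inP z -> cycleD z ->
    (forall T, #|T| = r.+1 -> ~~ top_run M p.+1 T -> z T = 0) ->
  exists u : edges -> X r.+1, inP u /\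
    (forall T, #|T| = r.+1 -> ~~ top_run M p.+2 T -> z T - bdD u T = 0).
Proof.
move=> pM Pz cz run_z.
have lt_c : (M - p.+1 < n.+1)%N by have := ltn_ord M; lia.
have [c cpM] : exists c : 'I_n.+1, (c + p.+1 = M)%N.
  by exists (Ordinal lt_c) => /=; lia.
pose full U := all_le M U && [forall e : 'I_n.+1, (c <= e <= M)%N ==> (e \in U)].
have fullP U : full U -> (forall e, e \in U -> (e <= M)%N) /\
    (forall e : 'I_n.+1, (c <= e <= M)%N -> e \in U).
  move=> /andP[/forall_inP le_U /forallP run_U]; split=> // e ceM.
  by have /implyP := run_U e; apply.
pose u U : X r.+1 := if full U then
  (-1) ^+ cnt U c *: alt_degen (cnt U c) (z (U :\ c)) else 0.
exists u; split=> [T cT|T cT nT].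
  rewrite /u; case: ifP => [/fullP[_ /(_ c)]|_]; rewrite ?rpred0 // => cinT.
  rewrite rpredZ // alt_degen_P // Pz //; apply: succn_inj.
  by rewrite -cT [in RHS](cardsD1 c) cinT //; lia.
apply/eqP; rewrite subr_eq0; apply/eqP.
(* Among the faces at the edges from [c] to [M], [M] excluded, only the one at [c] is nonzero;
   [top_run_face] supplies the vanishing that [face_alt_degen] requires. *)
have face_u (U : edges) e : full U -> #|U| = r.+2 -> e \in U -> (c <= e < M)%N ->
    d r.+1 (cnt U e) (u U) = if e == c then (-1) ^+ cnt U c *: z (U :\ c) else 0.
  move=> fU cU eU ceM; have [le_U run_U] := fullP U fU.
  have cinU : c \in U by apply: run_U; rewrite leqnn; lia.
  have MU : M \in U by apply: run_U; rewrite leqnn andbT; lia.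
  have cU' : #|U :\ c| = r.+1 by move: cU; rewrite (cardsD1 c) cinU => -[].
  have eM : (cnt U e < cnt U M)%N by apply: cnt_lt => //; lia.
  have cM := cnt_lt_card MU.
  rewrite /u fU linearZ /= face_alt_degen; last 2 first.
  - have /(leq_cnt U) : (c <= e)%N by case/andP: ceM.
    by rewrite cU in cM; lia.
  - rewrite -(cnt_setD1 U c) => j tj.
    apply: (@top_run_face _ z M c p.+1 _ _ cpM cz run_z cU' _ _ _ tj).
    + by rewrite setD11.
    + by move=> f /setD1P[_]; apply: le_U.
    + by move=> f cfM; rewrite !inE run_U -?val_eqE /=; lia.
  have [->|ec] := eqVneq e c; first by rewrite eqxx.
  have lt_ce : (cnt U c < cnt U e)%N.
    by apply: cnt_lt => //; move: ec; rewrite -val_eqE /=; lia.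
  by rewrite ifF ?scaler0 //; lia.
have bdD_full e : e \notin T -> (forall f, f \notin T -> f != e -> ~~ full (f |: T)) ->
    bdD u T = (-1) ^+ cnt T e *: d r.+1 (cnt T e) (u (e |: T)).
  move=> eT fT; rewrite /bdD (bigD1 e) //= big1 ?addr0 // => f /andP[nfT fe].
  by rewrite /u (negPf (fT f nfT fe)) linear0 scaler0.
have bdD0 : (forall f, f \notin T -> ~~ full (f |: T)) -> bdD u T = 0.
  move=> fT; rewrite /bdD big1 // => f nfT.
  by rewrite /u (negPf (fT f nfT)) linear0 scaler0.
have [le_T|/forall_inPn[e eT eM]] := boolP (all_le M T); last first.
  rewrite run_z ?bdD0 //.
    move=> f _; apply/negP => /fullP[/(_ e)].
    by rewrite setU1r // (negPf eM) => /(_ isT).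
  by apply/negP => /top_runP[/(_ e eT)]; rewrite (negPf eM).
(* Now [M] is in [T] and some [e0] between [c] and [M] is missing, so only adding [e0] can make [T]
   full. *)
move: nT; rewrite /top_run le_T negb_imply /= => /andP[MT /forallPn[e0]].
rewrite negb_imply => /andP[/andP[ce0 e0M] e0T].
have nfull f : f \notin T -> f != e0 -> ~~ full (f |: T).
  move=> _ fe; apply/negP => /fullP[_ /(_ e0)]; rewrite !inE (eq_sym e0) (negPf fe).
  by rewrite (negPf e0T) => H; suff: false by []; apply: H; lia.
have e0neM : e0 != M by apply: contraNneq e0T => ->.
have e0M' : (e0 < M)%N by rewrite ltn_neqAle e0M andbT val_eqE.
rewrite (bdD_full e0) //; have [fU|nfU] := boolP (full (e0 |: T)); last first.
  rewrite /u (negPf nfU) linear0 scaler0 run_z //; apply: contra nfU.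
  move=> /top_runP[_ /(_ MT) runT]; apply/andP; split.
    apply/forall_inP => f /setU1P[->//|]; exact: (forall_inP le_T).
  apply/forallP => f; apply/implyP => /andP[cf fM]; rewrite !inE.
  have [//|fe0] := eqVneq f e0; apply: (runT) => //.
  rewrite ltnNge -ltnS; apply: contra fe0 => fc; rewrite -val_eqE /=.
  suff: ~~ (c < e0)%N by move: fc; rewrite -cpM; lia.
  by apply: contra e0T => ce; apply: runT => //; rewrite -cpM; lia.
have cU : #|e0 |: T| = r.+2 by rewrite cardsU1 e0T cT.
have := face_u _ e0 fU cU (setU11 _ _); rewrite cnt_setU1 => ->; last by lia.
(* For [e0 = c] the boundary returns [z T]; for a later [e0] it is zero, and so is [z T], whose run
   is broken at [e0]. *)
have [e0c|e0c] := eqVneq e0 c.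
  by rewrite -e0c cnt_setU1 setU1K // signZK.
rewrite scaler0 run_z //; apply/negP => /top_runP[_ /(_ MT e0)].
rewrite (negPf e0T) => H; suff: false by []; apply: H => //.
by move: e0c; rewrite -val_eqE /=; lia.
Qed.

Lemma card_initial r : (r <= n)%N -> #|[set e : 'I_n.+1 | (e <= r)%N]| = r.+1.
Proof.
move=> rn; rewrite cardsE -sum1_card -[RHS]card_ord -sum1_card.
by rewrite (big_ord_widen n.+1 (fun=> 1%N)).
Qed.

Lemma max_descent r (z : edges -> X r) (M : 'I_n.+1) : (r < M)%N ->
    inP z -> cycleD z ->
    (forall T, #|T| = r.+1 -> ~~ all_le M T -> z T = 0) ->
  exists u : edges -> X r.+1, inP u /\
    (forall T, #|T| = r.+1 -> ~~ all_le M.-1 T -> z T - bdD u T = 0).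
Proof.
move=> rM Pz cz le_z.
(* For [p = M] the run would be all of {0, ..., M}, which has more than [r.+1] elements; hence no
   surviving set contains [M]. *)
suff gen p : (p <= M)%N -> exists u : edges -> X r.+1, inP u /\
    (forall T, #|T| = r.+1 -> ~~ top_run M p.+1 T -> z T - bdD u T = 0).
  have [u [Pu zu]] := gen _ (leqnn M); exists u; split=> // T cT.
  move=> /forall_inPn[e eT eM]; apply: zu => //; apply/negP => /top_runP[le_T run_T].
  have eM' : e = M by apply: val_inj => /=; have := le_T e eT; lia.
  suff: (#|[set f : 'I_n.+1 | (f <= M)%N]| <= #|T|)%N.
    by rewrite card_initial ?cT; have := ltn_ord M; lia.
  apply/subset_leq_card/subsetP => f; rewrite inE => fM.
  by apply: run_T => //; [rewrite -eM' | lia].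
elim: p => [_|p IHp pM].
  exists (fun=> 0); split=> [T _|T cT nT]; first exact: rpred0.
  rewrite [bdD _ _]big1 ?subr0 => [|e _]; last by rewrite linear0 scaler0.
  apply: le_z => //; apply: contra nT => /forall_inP le_T; apply/top_runP; split=> //.
  move=> MT e Me eM; suff -> : e = M by [].
  by apply: val_inj => /=; lia.
have [|u [Pu zu]] := IHp; first by lia.
have [|T cT||u' [Pu' zu']] := top_run_step pM (z := fun T => z T - bdD u T).
- by move=> T cT; rewrite submodB ?Pz //; apply: (bdD_P Pu).
- exact: cycleDB (cycle_bdD _) _ _.
- exact: zu.
exists (fun T => u T + u' T); split=> [T cT|T cT nT].
  by rewrite rpredD ?Pu ?Pu'.
by rewrite bdDD opprD addrA zu'.
Qed.

(** Descend on the largest element from [n] to [r]: a set of [r.+1] edges bounded by [r] is the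
    initial segment. *)
Lemma cycle_initial r (z : edges -> X r) : (r <= n)%N -> inP z -> cycleD z ->
  exists u : edges -> X r.+1, inP u /\
    (forall T, #|T| = r.+1 -> T != [set e : 'I_n.+1 | (e <= r)%N] ->
       z T - bdD u T = 0).
Proof.
move=> rn Pz cz; suff gen m : (m <= n - r)%N -> exists u : edges -> X r.+1,
    inP u /\ (forall T, #|T| = r.+1 -> ~~ all_le (n - m) T -> z T - bdD u T = 0).
  have [u [Pu zu]] := gen _ (leqnn _); exists u; split=> // T cT nT.
  apply: zu => //; apply: contra nT; rewrite subKn // => /forall_inP le_T.
  rewrite eqEcard card_initial // cT leqnn andbT.
  by apply/subsetP => e /le_T; rewrite inE.
elim: m => [_|m IHm mr].
  exists (fun=> 0); split=> [T _|T cT]; first exact: rpred0.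
  by move=> /forall_inPn[e _]; have := ltn_ord e; lia.
have [|u [Pu zu]] := IHm; first by lia.
have lt_M : (n - m < n.+1)%N by lia.
have [||||u' [Pu' zu']] := @max_descent _ (fun T => z T - bdD u T) (Ordinal lt_M).
- by rewrite /=; lia.
- by move=> T cT; rewrite submodB ?Pz //; apply: (bdD_P Pu).
- exact: cycleDB (cycle_bdD _).
- exact: zu.
exists (fun T => u T + u' T); split=> [T cT|T cT nT].
  by rewrite rpredD ?Pu ?Pu'.
by rewrite bdDD opprD addrA zu' //= -subnS.
Qed.

(** * Comparison of D with the simplicial module *)

Definition sumD r (z : edges -> X r) : X r := \sum_(T : edges | #|T| == r.+1) z T.

Lemma sumDB r (z z' : edges -> X r) :
  sumD (fun T => z T - z' T) = sumD z - sumD z'.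
Proof. by rewrite /sumD sumrB. Qed.

Lemma sumD_P r (z : edges -> X r) : inP z -> sumD z \in P r.
Proof. by move=> Pz; apply: rpred_sum => T /eqP/Pz. Qed.

(** The pairs of a set [S] and an edge outside it correspond to the pairs of a set [T] and an edge
    in it; by [sum_cnt], each [T] contributes the full alternating sum of faces of [u T]. *)
Lemma sumD_bdD r (u : edges -> X r.+1) : sumD (bdD u) = bd (sumD u).
Proof.
pose G T e := (-1) ^+ cnt T e *: d r.+1 (cnt T e) (u T).
transitivity (\sum_(T : edges | #|T| == r.+2) \sum_(e in T) G T e); last first.
  rewrite /sumD linear_sum; apply: eq_bigr => T /eqP cT.
  by rewrite (sum_cnt T (fun i => (-1) ^+ i *: d r.+1 i (u T))) cT.
rewrite (exchange_big_dep predT) //= /sumD /bdD.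
rewrite (exchange_big_dep predT) //=; apply: eq_bigr => e _.
rewrite [RHS](reindex_onto (fun S => e |: S) (fun T => T :\ e)) /=; last first.
  by move=> T /andP[_ eT]; rewrite setD1K.
apply: eq_big => [S|S /andP[_ eS]]; last by rewrite /G cnt_setU1.
rewrite setU11 andbT cardsU1; case: (boolP (e \in S)) => eS /=.
  rewrite andbF add0n; apply/esym/negbTE/negP => /andP[_ /eqP/setP/(_ e)].
  by rewrite !inE eqxx eS.
by rewrite setU1K // eqxx !andbT.
Qed.

Definition single r (y : X r) T : X r :=
  if T == [set e : 'I_n.+1 | (e <= r)%N] then y else 0.

Lemma inP_single r (y : X r) : y \in P r -> inP (single y).
Proof. by move=> Py T _; rewrite /single; case: ifP; rewrite ?rpred0. Qed.

Lemma sumD_single r (y : X r) : (r <= n)%N -> sumD (single y) = y.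
Proof.
move=> rn; rewrite /sumD (bigD1 [set e : 'I_n.+1 | (e <= r)%N]) /=; last first.
  by rewrite card_initial.
rewrite big1 ?addr0 /single ?eqxx // => T /andP[_ /negPf->] //.
Qed.

Lemma bdD_single r (y : X r) S e : (r <= n)%N -> #|S| = r -> e \notin S ->
    e |: S = [set e : 'I_n.+1 | (e <= r)%N] ->
  bdD (single y) S = (-1) ^+ cnt S e *: d r (cnt S e) y.
Proof.
move=> rn cS eS eU; rewrite /bdD (bigD1 e) //= /single eU eqxx.
rewrite big1 ?addr0 // => f /andP[fS fe]; rewrite ifN ?linear0 ?scaler0 //.
apply: contraNneq fe => /setP/(_ f); rewrite -eU !inE eqxx (negPf fS) orbF.
by rewrite orbF => <-.
Qed.

Lemma sumD_surj r (y : X r) : (r <= n)%N -> y \in P r -> bd y = 0 ->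
  exists z w, [/\ inP z, cycleD z, w \in P r.+1 & y - sumD z = bd w].
Proof.
move=> rn Py by0; have [y' [w [Py' Pw yw dy']]] := cycle_moore Py by0.
exists (single y'), w; rewrite sumD_single //; split=> //; first exact: inP_single.
move=> S cS; rewrite /bdD big1 // => e eS; rewrite /single; case: ifP => _.
  by rewrite dy' ?scaler0 // -cS cnt_leq_card.
by rewrite linear0 scaler0.
Qed.

(** Only the last face of [w] survives, and it removes the edge [r.+1], leaving the initial segment
    with [r.+1] elements. *)
Lemma bdD_single_moore r (w : X r.+1) T : (r < n)%N -> moore r.+1 w ->
  #|T| = r.+1 -> bdD (single w) T = single (bd w) T.
Proof.
move=> rn mw cT; pose e0 : 'I_n.+1 := inord r.+1; have vale0 : e0 = r.+1 :> nat.
  by rewrite /e0 inordK.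
have initS : e0 |: [set e : 'I_n.+1 | (e <= r)%N] = [set e : 'I_n.+1 | (e <= r.+1)%N].
  by apply/setP => f; rewrite !inE -val_eqE /= vale0 [in RHS]leq_eqVlt.
have e0r : e0 \notin [set e : 'I_n.+1 | (e <= r)%N] by rewrite inE vale0 ltnn.
rewrite /(single (bd w)); have [TI|nTI] := eqVneq.
  have := @bdD_single r.+1 w T e0 rn cT; rewrite TI => -> //; rewrite moore_last //.
  suff -> : cnt [set e : 'I_n.+1 | (e <= r)%N] e0 = r.+1 by [].
  rewrite -cT TI; congr #|pred_of_set _|; apply/setP => f.
  by rewrite !inE vale0 ltnS andbb.
rewrite /bdD big1 // => e eT; have := cnt_leq_card T e; rewrite cT leq_eqVlt.
case/predU1P => [eT'|lt_e]; last first.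
  by rewrite /single; case: ifP => _; rewrite ?linear0 ?scaler0 // mw ?scaler0.
rewrite /single ifN ?linear0 ?scaler0 //; apply: contra nTI => /eqP eTI.
(* Here [e] has the largest rank in {0, ..., r+1}, so it is [r.+1]. *)
suff e0e : e = e0 by rewrite -(setU1K eT) eTI -initS e0e setU1K.
apply: contraTeq isT => ee0; have e0T : e0 \in T.
  by have /setP/(_ e0) := eTI; rewrite !inE eq_sym (negPf ee0) vale0 leqnn.
have ee0' : (e <= e0)%N.
  by rewrite vale0; have /setP/(_ e) := eTI; rewrite !inE eqxx => <-.
by have := leq_ltn_trans (leq_cnt T ee0') (cnt_lt_card e0T); rewrite eT' cT ltnn.
Qed.

(** After moving [z] to the initial segment, the bounding chain [w - sumD u] is normalised and
    placed on the segment with [r.+2] elements, which exists because [r < n]. *)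
Lemma sumD_inj r (z : edges -> X r) (w : X r.+1) : (r < n)%N ->
    inP z -> cycleD z -> w \in P r.+1 -> sumD z = bd w ->
  exists u : edges -> X r.+1, inP u /\ forall T, #|T| = r.+1 -> z T = bdD u T.
Proof.
move=> rn Pz cz Pw zw; have [u [Pu zu]] := cycle_initial (ltnW rn) Pz cz.
set I := [set e : 'I_n.+1 | (e <= r)%N]; pose y := z I - bdD u I.
have z'y T : #|T| = r.+1 -> z T - bdD u T = single y T.
  by move=> cT; rewrite /single; case: eqVneq => [->|/zu->].
have yw : y = bd (w - sumD u).
  rewrite linearB /= -zw -sumD_bdD -sumDB -[LHS](sumD_single _ (ltnW rn)).
  by apply: eq_bigr => T /eqP/z'y->.
(* Removing from the segment its edge of rank [j] isolates [d r j y], up to sign, in the cycle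
   condition for [single y]. *)
have dy j : (j <= r)%N -> d r j (bd (w - sumD u)) = 0.
  rewrite -yw -ltnS -(card_initial (ltnW rn)) => /cnt_surj[e eI <-].
  have cI : #|I :\ e| = r.
    by apply: succn_inj; rewrite -(card_initial (ltnW rn)) [in RHS](cardsD1 e) eI.
  rewrite -(signZK (cnt I e) (d _ _ _)) -cnt_setD1.
  rewrite -(@bdD_single _ _ (I :\ e) e) ?setD11 ?setD1K // ?(ltnW rn) //.
  suff -> : bdD (single y) (I :\ e) = 0 by rewrite scaler0.
  transitivity (bdD (fun T => z T - bdD u T) (I :\ e)).
    by apply: eq_bdD => // T /z'y.
  by rewrite bdDB cz // cycle_bdD // subrr.
have Pw' : w - sumD u \in P r.+1 by rewrite submodB // sumD_P.
have [w' [{}Pw' bw' mw']] := boundary_moore Pw' dy.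
exists (fun U => u U + single w' U); split=> [U cU|T cT].
  by rewrite rpredD ?Pu ?inP_single.
by rewrite bdDD bdD_single_moore // bw' -yw -z'y // addrC subrK.
Qed.

End Moore.

(** * The simplicial structure of the Hochschild complex *)

Section HochschildSimplicial.
Variables (k : comPzRingType) (A : algType k) (M : bimodType A).
Implicit Types (m : M) (al : nat -> A).

(* Indexing the factors by nat makes the simplicial identities plain case
   analyses. *)
Definition npure r m al : chains M r := pure m (fun j : 'I_r => al j).

Lemma eq_npure r m m' al al' : m = m' -> (forall j, (j < r)%N -> al j = al' j) ->
  npure r m al = npure r m' al'.
Proof. by move=> -> E; congr pure; apply/funext => j; apply: E. Qed.

Lemma pure_npure r m (a : 'I_r -> A) :
  pure m a = npure r m (fun l => oapp a 1 (insub l)).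
Proof. by congr pure; apply/funext => j; rewrite valK. Qed.

Lemma npure_ext r (U : lmodType k) (f g : {linear chains M r -> U}) :
  (forall m al, f (npure r m al) = g (npure r m al)) -> f =1 g.
Proof.
move=> fg x; have [s ->] := tensorE x; rewrite !linear_sum.
by apply: eq_bigr => p _; rewrite !linearZ pure_npure /= fg.
Qed.

(** [inord] makes the index total; the identities below concern indices in range. *)
Definition nface r (i : nat) : {linear chains M r -> chains M r.-1} :=
  match r return {linear chains M r -> chains M r.-1} with
  | 0 => \0
  | r'.+1 => face M (inord i)
  end.

Definition nface_mod r i m al : M :=
  if i == 0%N then ract m (al 0%N) else if i == r.+1 then lact (al r) m else m.

Definition nface_alg i al : nat -> A := fun j =>
  if (j.+1 < i)%N then al j else if j.+1 == i then al j * al j.+1 else al j.+1.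

Lemma nface_npure r i m al : (i <= r.+1)%N ->
  nface r.+1 i (npure r.+1 m al) = npure r (nface_mod r i m al) (nface_alg i al).
Proof.
move=> ir; rewrite /= /face /npure tlift_pure /= /face_mod inordK //.
congr pure; apply/funext => j; rewrite /face_alg /nface_alg inordK //.
Qed.

Definition degen_alg r (i : 'I_r.+1) (a : 'I_r -> A) : 'I_r.+1 -> A :=
  fun j => oapp a 1 (unlift i j).

Fact degen_multilinear r (i : 'I_r.+1) :
  multilinear (fun m a => pure m (degen_alg i a) : chains M r.+1).
Proof.
apply: (@pure_comp_multilinear _ _ _ _ _ (fun m _ => m) (degen_alg i)) => // l.
right; split=> //; exists (lift i l) => a; exists id => // x.
apply/funext => j; rewrite /degen_alg /upd.
case: unliftP => [j' ->|->]; first by rewrite (inj_eq lift_inj).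
by rewrite (negPf (neq_lift _ _)).
Qed.

Definition ndegen r (i : nat) : {linear chains M r -> chains M r.+1} :=
  tlift (Multilin (degen_multilinear (inord i : 'I_r.+1))).

Definition ndegen_alg i al : nat -> A := fun j =>
  if (j < i)%N then al j else if j == i then 1 else al j.-1.

Lemma ndegen_npure r i m al : (i <= r)%N ->
  ndegen r i (npure r m al) = npure r.+1 m (ndegen_alg i al).
Proof.
move=> ir; rewrite /ndegen /npure [LHS]tlift_pure /=.
congr pure; apply/funext => j; rewrite /degen_alg /ndegen_alg.
case: unliftP => [j' ->|->] /=; rewrite inordK //; last by rewrite ltnn eqxx.
rewrite /bump; case: (leqP i j') => ij /=.
  by rewrite add1n !ifN // ?gtn_eqF -?leqNgt // ltnW.
by rewrite add0n ij.
Qed.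

Lemma nface0 i x : nface 0 i x = 0.
Proof. by []. Qed.

(** The cases that change the coefficient twice are the three bimodule laws: [ractM] for (0, 1),
    [lractA] for (0, r+2) and [lactM] for (r+1, r+2). *)
Lemma nface_mod_comm r i j m al : (i < j <= r.+2)%N ->
  nface_mod r i (nface_mod r.+1 j m al) (nface_alg j al) =
  nface_mod r j.-1 (nface_mod r.+1 i m al) (nface_alg i al).
Proof.
case: j => // j; rewrite ltnS => /andP[ij jr]; rewrite /nface_mod /= eqSS.
rewrite /nface_alg (_ : i == r.+2 = false); last by lia.
have [i0|i0] := eqVneq i 0%N.
  have [j0|j0] := eqVneq j 0%N.
    by rewrite j0 i0 /= ractM.
  have -> : (1 < j.+1)%N by lia.
  rewrite i0 (_ : r.+1 == 0%N = false) //; case: ifP => // _.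
  by rewrite lractA.
rewrite (_ : j == 0%N = false); last by lia.
have [jr'|jr'] := eqVneq j r.+1; last by rewrite ifN //; lia.
have [ir|ir] := eqVneq i r.+1; last first.
  by rewrite !ifN //; lia.
by rewrite jr' ltnSn ir ltnn lactM.
Qed.

Lemma nface_nface r i j x : (i < j <= r.+2)%N ->
  nface r.+1 i (nface r.+2 j x) = nface r.+1 j.-1 (nface r.+2 i x).
Proof.
move=> ijr; move: x; apply: (npure_ext (f := nface r.+1 i \o nface r.+2 j)
  (g := nface r.+1 j.-1 \o nface r.+2 i)) => m al.
rewrite [LHS]/= [RHS]/=; rewrite !nface_npure; try lia.
apply: eq_npure; first exact: nface_mod_comm.
move=> l _; rewrite /nface_alg; case: j ijr => // j ijr.
by repeat case: ifP => ? //; rewrite ?mulrA //; lia.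
Qed.

Lemma nface_ndegen_lt r i j x : (i < j <= r.+1)%N ->
  nface r.+2 i (ndegen r.+1 j x) = ndegen r j.-1 (nface r.+1 i x).
Proof.
move=> ijr; move: x; apply: (npure_ext (f := nface r.+2 i \o ndegen r.+1 j)
  (g := ndegen r j.-1 \o nface r.+1 i)) => m al.
rewrite [LHS]/= [RHS]/= !(nface_npure, ndegen_npure); try lia.
apply: eq_npure.
  rewrite /nface_mod /ndegen_alg; case: j ijr => // j ijr.
  rewrite ltn0Sn (_ : (i == r.+2) = false); last by lia.
  have [//|i0] := eqVneq i 0%N.
  by have -> : (i == r.+1) = false by lia.
move=> l _; rewrite /nface_alg /ndegen_alg; case: j ijr => // j ijr.
case: l => [|l]; first by repeat case: ifP => ? //; rewrite ?mulr1 ?mul1r //; lia.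
by repeat case: ifP => ? //; rewrite ?mulr1 ?mul1r //; lia.
Qed.

Lemma nface_ndegen_id r j x : (j <= r)%N -> nface r.+1 j (ndegen r j x) = x.
Proof.
move=> jr; move: x; apply: (npure_ext (f := nface r.+1 j \o ndegen r j)
  (g := idfun)) => m al.
rewrite [LHS]/= [RHS]/= ndegen_npure // nface_npure; last by lia.
apply: eq_npure.
  rewrite /nface_mod /ndegen_alg; have [->|j0] := eqVneq j 0%N.
    by rewrite ract1.
  by rewrite (_ : j == r.+1 = false) //; lia.
move=> l _; rewrite /nface_alg /ndegen_alg.
by repeat case: ifP => ? //; rewrite ?mulr1 ?mul1r //; lia.
Qed.

Lemma nface_ndegen_idS r j x : (j <= r)%N -> nface r.+1 j.+1 (ndegen r j x) = x.
Proof.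
move=> jr; move: x; apply: (npure_ext (f := nface r.+1 j.+1 \o ndegen r j)
  (g := idfun)) => m al.
rewrite [LHS]/= [RHS]/= ndegen_npure // nface_npure; last by lia.
apply: eq_npure.
  rewrite /nface_mod /ndegen_alg /= eqSS; case: eqP => // ->.
  by rewrite ltnn eqxx lact1.
move=> l _; rewrite /nface_alg /ndegen_alg.
by repeat case: ifP => ? //; rewrite ?mulr1 ?mul1r //; lia.
Qed.

Lemma nface_ndegen_gt r i j x : (j.+1 < i <= r.+2)%N ->
  nface r.+2 i (ndegen r.+1 j x) = ndegen r j (nface r.+1 i.-1 x).
Proof.
move=> ijr; move: x; apply: (npure_ext (f := nface r.+2 i \o ndegen r.+1 j)
  (g := ndegen r j \o nface r.+1 i.-1)) => m al.
rewrite [LHS]/= [RHS]/= !(nface_npure, ndegen_npure); try lia.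
apply: eq_npure.
  rewrite /nface_mod /ndegen_alg; case: i ijr => // -[|i] ijr; first by lia.
  rewrite /= !eqSS; case: eqP => // ir.
  by rewrite !ifN //; lia.
move=> l _; rewrite /nface_alg /ndegen_alg; case: i ijr => // i ijr.
case: l => [|l]; first by repeat case: ifP => ? //; rewrite ?mulr1 ?mul1r //; lia.
by repeat case: ifP => ? //; rewrite ?mulr1 ?mul1r //; lia.
Qed.

Lemma hboundaryE r x : hboundary M r x = bd nface x.
Proof.
case: r x => [|r] x; first by rewrite /bd big_ord1 scaler0.
by apply: eq_bigr => i _; rewrite /= inord_val.
Qed.

(** * Faces and degeneracies preserve internal degree *)

Section Degrees.
Variables (grA : int -> submodClosed A) (grM : int -> submodClosed M).
Hypotheses (hA : graded_algebra grA) (hM : graded_bimodule grA grM).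

Lemma linear_lspan (V W : lmodType k) (P : V -> Prop) (S : submodClosed W)
    (f : {linear V -> W}) x :
  (forall v, P v -> f v \in S) -> x \in lspan P -> f x \in S.
Proof.
move=> PS /asboolP[t [Pt ->]]; rewrite linear_sum big_seq.
by apply: rpred_sum => p /Pt/PS Sp; rewrite linearZ rpredZ.
Qed.

(** Degree bookkeeping for the face [i]: the first two terms are the factor absorbed by the module,
    and the [j]-th summand is the degree of the [j]-th factor of the result. *)
Lemma sum_split_at r (i : 'I_r.+2) (dg : 'I_r.+1 -> int) :
  \sum_(l < r.+1) dg l =
    (if i == 0%N :> nat then dg ord0 else 0) +
    (if i == r.+1 :> nat then dg ord_max else 0) +
    \sum_(j < r) ((if (j < i)%N then dg (widen_ord (leqnSn r) j) else 0) +
                  (if (i <= j.+1)%N then dg (lift ord0 j) else 0)).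
Proof.
transitivity (\sum_(l < r.+1) ((if (l < i)%N then dg l else 0) +
                               (if (i <= l)%N then dg l else 0))).
  by apply: eq_bigr => l _; case: ltnP => _; rewrite ?addr0 ?add0r.
rewrite big_split big_ord_recr big_ord_recl /= big_split /=.
have lt_i := ltn_ord i; have -> : (r < i)%N = (i == r.+1 :> nat) by lia.
by rewrite leqn0 [LHS]addrACA [RHS]addrACA; congr (_ + _); rewrite addrC.
Qed.

Lemma nface_deg r i j x : (i <= r)%N -> x \in tensor_deg grA grM r j ->
  nface r i x \in tensor_deg grA grM r.-1 j.
Proof.
case: r x => [|r] x ir; first by move=> _; rewrite nface0 rpred0.
apply: linear_lspan => v [d0 dg m a mM aA <-] /=.
have lt_i : (i < r.+2)%N by lia.
rewrite (_ : inord i = Ordinal lt_i); last by apply: val_inj; rewrite /= inordK.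
rewrite /face tlift_pure /=; apply: lspan_gen.
pose dg' (l : 'I_r) := if (l.+1 < i)%N then dg (widen_ord (leqnSn r) l)
  else if l.+1 == i then dg (widen_ord (leqnSn r) l) + dg (lift ord0 l)
  else dg (lift ord0 l).
pose d0' := if i == 0%N then d0 + dg ord0
  else if i == r.+1 then dg ord_max + d0 else d0.
have [_ _ mulA] := hA; have [_ mulL mulR] := hM.
apply: (@PureOfDeg _ _ _ grA grM _ _ d0' dg') => [|l|].
- rewrite /face_mod /d0' /=; case: ifP => _; first exact: mulR.
  by case: ifP => _ //; exact: mulL.
- by rewrite /face_alg /dg' /=; case: ifP => _ //; case: ifP => _ //; exact: mulA.
rewrite (sum_split_at (Ordinal lt_i)) /= addrA; congr (_ + _).
  rewrite /d0'; case: (eqVneq i 0%N) => [->|_]; first by rewrite addr0.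
  by rewrite add0r; case: ifP; rewrite ?addr0 // addrC.
apply: eq_bigr => l _; rewrite /dg'.
by case: (ltngtP l.+1 i) => _; rewrite ?addr0 ?add0r.
Qed.

Lemma ndegen_deg r i j x : (i <= r)%N -> x \in tensor_deg grA grM r j ->
  ndegen r i x \in tensor_deg grA grM r.+1 j.
Proof.
move=> ir; apply: linear_lspan => v [d0 dg m a mM aA <-] /=.
rewrite /ndegen [X in X \in _]tlift_pure /=; apply: lspan_gen.
pose dg' (l : 'I_r.+1) := oapp dg 0 (unlift (inord i) l).
apply: (@PureOfDeg _ _ _ grA grM _ _ d0 dg') => //.
  move=> l; rewrite /dg' /degen_alg; case: unliftP => [l' _|_] //=.
  by case: hA.
rewrite (bigD1_ord (inord i)) //= /dg' unlift_none /= add0r; congr (_ + _).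
by apply: eq_bigr => l _; rewrite liftK.
Qed.

End Degrees.

End HochschildSimplicial.

(** * The components of a subgraph of the polygon *)

Section PolygonComponents.
Variable n : nat.
Implicit Types (s : {set 'I_n.+1}) (e u v w : 'I_n.+1).

Lemma sorted_enum_ord (a : {pred 'I_n.+1}) :
  sorted (fun u v : 'I_n.+1 => u < v)%N (enum a).
Proof.
rewrite {1}/enum_mem; apply: sorted_filter => [x y z|]; first exact: ltn_trans.
by rewrite -enumT; have := iota_ltn_sorted 0 n.+1; rewrite -val_enum_ord sorted_map.
Qed.

Lemma ordS_neq_max e : (e < n)%N -> ordS e = e.+1 :> nat.
Proof. by move=> en; rewrite /= modn_small. Qed.

Lemma ordS_max e : e = n :> nat -> ordS e = ord0.
Proof. by move=> en; apply: val_inj; rewrite /= en modnn. Qed.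

(** The congruence absorbs the return to [v_0] after the last edge, where the count falls from
    [#|T|] to 0. *)
Lemma cnt_ordS (T : {set 'I_n.+1}) e :
  cnt T (ordS e) = (cnt T e + (e \in T))%N %[mod #|T|].
Proof.
have [en|en] := ltnP e n; first by rewrite ordS_neq_max // cntS.
have en' : e = n :> nat by have := ltn_ord e; lia.
by rewrite ordS_max // -cntS en' cnt_max cnt0 mod0n modnn.
Qed.

(* The position of the component of v, computed by counting the missing edges
   before v; the components are delimited by the missing edges. *)
Definition arc s v : nat := (cnt (~: s) v %% #|~: s|)%N.

Lemma connect_arc s u v : connect (adj s) u v -> arc s u = arc s v.
Proof.
have arc_ordS w : w \in s -> arc s (ordS w) = arc s w.
  by move=> ws; rewrite /arc cnt_ordS inE ws addn0.
case/connectP=> p; elim: p u => [|w p IHp] u /= => [_ -> //|].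
case/andP=> [uw /IHp wv /wv <-].
by case/orP: uw => /andP[ws /eqP->]; rewrite arc_ordS.
Qed.

(** A constant count means that all edges from [u] to [v] are present. *)
Lemma cnt_connect s u v : (u <= v)%N -> cnt (~: s) u = cnt (~: s) v ->
  connect (adj s) u v.
Proof.
move: {2}(v - u)%N (erefl (v - u)%N) => m; elim: m v => [|m IHm] v vu uv cuv.
  by have -> : u = v by apply: val_inj => /=; lia.
have lt_w : (v.-1 < n.+1)%N by have := ltn_ord v; lia.
have [w vw] : exists w : 'I_n.+1, v = w.+1 :> nat.
  by exists (Ordinal lt_w) => /=; lia.
have wv : ordS w = v.
  by apply: ord_inj; rewrite ordS_neq_max ?vw //; have := ltn_ord v; lia.
have cS := cntS (~: s) w; rewrite -vw in cS; have uw : (u <= w)%N by lia.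
have cuw := leq_cnt (~: s) uw.
have ws : w \in s by move: cS; rewrite inE; case: (w \in s) => //= cS; lia.
apply: (connect_trans (y := w)); last by rewrite -wv adj_edge.
by apply: IHm => //=; [lia | rewrite inE ws in cS; lia].
Qed.

Lemma arc_connect s u v : s != setT -> arc s u = arc s v -> connect (adj s) u v.
Proof.
move=> sT; have T0 : (0 < #|~: s|)%N.
  by rewrite card_gt0; apply: contra sT => /eqP sC; rewrite -[s]setCK sC setC0.
(* A vertex of arc 0 lies before the first missing edge or after the last one. In the second case
   the closing edge [n] is present and leads back to [v_0]. *)
have arc0 w : arc s w = 0%N -> connect (adj s) ord0 w.
  move=> w0; have := cnt_leq_card (~: s) w; rewrite leq_eqVlt => /predU1P[wT|lt_w].
    rewrite (adj_csym s); have wn : (w <= @ord_max n)%N by rewrite -ltnS /=.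
    have cn := cntS (~: s) ord_max; rewrite cnt_max in cn.
    have cwn := leq_cnt (~: s) wn; rewrite wT in cwn.
    have ns : ord_max \in s by rewrite -[_ \in s]negbK -in_setC; lia.
    apply: (connect_trans (cnt_connect wn _)); first by rewrite inE ns in cn; lia.
    by rewrite -(ordS_max (erefl : val ord_max = n)) adj_edge.
  by apply: cnt_connect => //; move: w0; rewrite /arc modn_small // cnt0.
have arcS w : (0 < arc s w)%N -> arc s w = cnt (~: s) w.
  have := cnt_leq_card (~: s) w; rewrite /arc leq_eqVlt => /predU1P[->|lt_w].
    by rewrite modnn.
  by rewrite modn_small.
move=> uv; have [u0|u0] := posnP (arc s u).
  by apply: connect_trans (arc0 v _); [rewrite (adj_csym s) arc0|rewrite -uv].
have cuv : cnt (~: s) u = cnt (~: s) v by rewrite -!arcS // -uv.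
have [le_uv|/ltnW le_vu] := leqP u v; first exact: cnt_connect.
by rewrite (adj_csym s) cnt_connect.
Qed.

(** Roots are the smallest vertices of their components, so [arc] increases strictly along them; it
    takes every value below the number of missing edges. *)
Lemma map_arc_comps s : s != setT -> map (arc s) (comps s) = iota 0 #|~: s|.
Proof.
move=> sT; have T0 : (0 < #|~: s|)%N.
  by rewrite card_gt0; apply: contra sT => /eqP sC; rewrite -[s]setCK sC setC0.
have root_arc w : arc s (fingraph.root (adj s) w) = arc s w.
  by apply/esym/connect_arc/connect_root.
apply: (irr_sorted_eq ltn_trans ltnn _ (iota_ltn_sorted _ _)).
  apply: (homo_sorted_in (P := mem (comps s)) _ (allss _) (sorted_enum_ord _)).
  move=> u v us vs uv; have ru : u \in fingraph.roots (adj s) by rewrite -mem_enum.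
  have rv : v \in fingraph.roots (adj s) by rewrite -mem_enum.
  have neq : arc s u != arc s v.
    apply: contraL uv => /eqP/(arc_connect sT)/(fingraph.rootP (adj_csym s)).
    by rewrite (eqP ru) (eqP rv) => ->; rewrite ltnn.
  (* A root after the last missing edge would be connected to [v_0], hence equal to it, where the
     count is 0. *)
  have cnt_small w : w \in fingraph.roots (adj s) -> arc s w = cnt (~: s) w.
    move=> rw; have := cnt_leq_card (~: s) w; rewrite leq_eqVlt => /predU1P[wT|lt_w].
      have : arc s ord0 = arc s w by rewrite /arc wT modnn cnt0 mod0n.
      move=> /(arc_connect sT); rewrite (adj_csym s) => /root_le.
      by rewrite (eqP rw) leqn0 => /eqP w0; move: wT T0; rewrite w0 cnt0 => <-.
    by rewrite /arc modn_small.
  by rewrite ltn_neqAle neq !cnt_small // leq_cnt // ltnW.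
move=> j; rewrite mem_iota add0n leq0n /=; apply/mapP/idP.
  by case=> w _ ->; rewrite ltn_pmod.
case/cnt_surj=> e eT <-; exists (fingraph.root (adj s) e).
  by rewrite mem_enum; apply: (roots_root (adj_csym s)).
by rewrite root_arc /arc modn_small // cnt_lt_card.
Qed.

Lemma ncomp_card s : s != setT -> ncomp s = #|~: s|.
Proof.
by move=> sT; rewrite -size_comps -(size_map (arc s)) map_arc_comps // size_iota.
Qed.

Lemma comp_pos_arc s v : s != setT -> comp_pos s v = arc s v.
Proof.
move=> sT; have lt_p := comp_pos_lt s v.
have : nth 0%N (map (arc s) (comps s)) (comp_pos s v) = comp_pos s v.
  by rewrite map_arc_comps // nth_iota -?ncomp_card.
rewrite (nth_map ord0) ?size_comps // => <-.
rewrite /comp_pos nth_index; last by rewrite mem_enum; apply: (roots_root (adj_csym s)).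
by apply: connect_arc; rewrite (adj_csym s) connect_root.
Qed.

End PolygonComponents.

(** * Merging two arcs is a Hochschild face *)

Section EdgeMaps.
Variables (k : comPzRingType) (A : algType k) (M : bimodType A) (n : nat).
Implicit Types (s : {set 'I_n.+1}) (e : 'I_n.+1) (al : nat -> A).

Lemma comp_idx_arc s v : s != setT ->
  (if comp_idx s v is Some j then j.+1 else 0%N) = arc s v.
Proof. by move=> sT; rewrite -comp_posE comp_pos_arc. Qed.

Lemma weight_arc s al v : s != setT ->
  weight (fun j : 'I_(ncomp s).-1 => al j) (comp_idx s v) =
  if arc s v is p.+1 then al p else 1.
Proof. by move=> sT; rewrite -comp_idx_arc //; case: comp_idx. Qed.

Lemma arc_small s (v : 'I_n.+1) : (cnt (~: s) v < #|~: s|)%N -> arc s v = cnt (~: s) v.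
Proof. exact: modn_small. Qed.

(** An edge of rank [p] among the missing ones joins the arcs [p] and [p.+1], cyclically. Arc 0
    carries the module and arc [j.+1] the factor [al j], so the ends [p = 0] and [p = r.+1] give the
    right and left actions. *)
Lemma merge_npure r s s' e (m : M) al :
    s' = e |: s -> e \notin s -> #|~: s'| = r.+1 ->
  Defs.merge s' e m (fun j : 'I_(ncomp s).-1 => al j) =
  npure (ncomp s').-1 (nface_mod r (cnt (~: s') e) m al)
    (nface_alg (cnt (~: s') e) al).
Proof.
move=> def_s' es cs'; pose p := cnt (~: s') e.
have sC : ~: s = e |: ~: s'.
  by rewrite def_s' setCU; apply/setP => f; rewrite !inE; case: eqVneq => // ->.
have es' : e \notin ~: s' by rewrite def_s' !inE eqxx.
have cs : #|~: s| = r.+2 by rewrite sC cardsU1 es' cs'.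
have nT (t : {set 'I_n.+1}) m' : #|~: t| = m'.+1 -> t != setT.
  by move=> ct; apply/eqP => tT; rewrite tT setCT cards0 in ct.
have sT := nT _ _ cs; have s'T := nT _ _ cs'.
have pr : (p <= r.+1)%N by rewrite -cs' cnt_leq_card.
have pE : cnt (~: s) e = p by rewrite sC cnt_setU1.
have arc_e : arc s e = p by rewrite arc_small ?pE ?cs.
have arc_Se : arc s (ordS e) = (p.+1 %% r.+2)%N.
  by rewrite /arc cnt_ordS pE inE es addn1 cs.
have arc_neq : arc s e != arc s (ordS e).
  rewrite arc_e arc_Se; move: pr; rewrite leq_eqVlt => /predU1P[->|pr].
    by rewrite modnn.
  by rewrite modn_small //; lia.
rewrite /Defs.merge ifN; last first.
  rewrite -comp_idx_arc // -[X in _ != X]comp_idx_arc // in arc_neq.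
  by apply: contra arc_neq => /eqP->.
rewrite /npure; congr pure.
  rewrite /merge_mod /nface_mod; move: (comp_idx_arc e sT) (comp_idx_arc (ordS e) sT).
  rewrite arc_e arc_Se -/p; have [pr1|pr1] := eqVneq p r.+1.
    rewrite pr1 modnn; case: (comp_idx s e) => [i|//] [ir].
    by case: (comp_idx s (ordS e)) => // _; rewrite ir.
  rewrite modn_small; last by lia.
  have [->|p0] := eqVneq p 0%N.
    by case: (comp_idx s e) => // _; case: (comp_idx s (ordS e)) => [i [->]|].
  case: (comp_idx s e) => [i _|/esym/eqP]; last by rewrite (negPf p0).
  by case: (comp_idx s (ordS e)).
apply/funext => j; set v := comp_rep j; rewrite /merge_alg /= -/v.
have jr : (j < r)%N by have := ltn_ord j; rewrite {2}(ncomp_card s'T) cs'.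
have arc_v : arc s' v = j.+1 by rewrite -comp_idx_arc // comp_repK.
have cv : cnt (~: s') v = j.+1.
  have := cnt_leq_card (~: s') v; rewrite leq_eqVlt => /predU1P[vT|lt_v].
    by move: arc_v; rewrite /arc vT modnn.
  by rewrite -arc_small.
(* Before [e] is added, the arcs after it are shifted by one. *)
have cvs : cnt (~: s) v = ((e < v) + j.+1)%N by rewrite sC cntU1 // cv.
have conn : connect (adj s') e v = (p == j.+1).
  apply/idP/eqP => [/connect_arc|pj].
    rewrite arc_v /arc -/p cs' => pj.
    move: pr; rewrite leq_eqVlt => /predU1P[pr|pr]; first by rewrite pr modnn in pj.
    by rewrite -pj modn_small.
  by apply: arc_connect => //; rewrite arc_v arc_small -/p pj // cs'; lia.
rewrite conn !weight_arc // arc_e arc_Se /nface_alg -/p eq_sym.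
have [pj|pj|pj] := ltngtP j.+1 p.
- have ve : (e < v)%N = false.
    by apply/negP => /ltnW/(leq_cnt (~: s')); rewrite cv -/p; lia.
  by rewrite arc_small cvs ve ?cs //=; lia.
- have ve : (e < v)%N.
    by rewrite ltnNge; apply/negP => /(leq_cnt (~: s')); rewrite cv -/p; lia.
  by rewrite arc_small cvs ve ?cs //=; lia.
by rewrite -pj modn_small //; lia.
Qed.

(** The exponent [(ncomp s).-1] of [Phi M s] equals [r] only by a proof. The value 0 for distinct
    exponents makes the transport a total linear map. *)
Definition chcast r1 r2 (x : chains M r1) : chains M r2 :=
  match r1 =P r2 with
  | ReflectT E => eq_rect r1 (fun r => chains M r) x r2 E
  | _ => 0
  end.

Lemma chcast_id r (x : chains M r) : chcast r x = x.
Proof. by rewrite /chcast; case: eqP => // E; rewrite (eq_axiomK E). Qed.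

Fact chcast_linear r1 r2 : linear (@chcast r1 r2).
Proof.
have [->|r12] := eqVneq r1 r2; first by move=> c x y; rewrite !chcast_id.
move=> c x y; rewrite /chcast; case: eqP => [E|_]; last by rewrite scaler0 addr0.
by rewrite E eqxx in r12.
Qed.

HB.instance Definition _ r1 r2 := GRing.isLinear.Build k (chains M r1)
  (chains M r2) *:%R (@chcast r1 r2) (@chcast_linear r1 r2).

Lemma chcastK r1 r2 : r1 = r2 -> cancel (@chcast r1 r2) (@chcast r2 r1).
Proof. by move=> -> x; rewrite !chcast_id. Qed.

Lemma chcast_npure r1 r2 (m : M) al : r1 = r2 -> chcast r2 (npure r1 m al) = npure r2 m al.
Proof. by move=> ->; rewrite chcast_id. Qed.

Lemma chcast_deg grA grM r1 r2 j (x : chains M r1) : r1 = r2 ->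
  x \in tensor_deg grA grM r1 j -> chcast r2 x \in tensor_deg grA grM r2 j.
Proof. by move=> <-; rewrite chcast_id. Qed.

Lemma edge_map_nface r s s' e (def_s' : s' = e |: s) (x : Phi M s) :
    e \notin s -> #|~: s'| = r.+1 ->
  chcast r (edge_map M def_s' x) =
    nface M r.+1 (cnt (~: s') e) (chcast r.+1 (x : chains M (ncomp s).-1)).
Proof.
move=> es cs'; have cs : #|~: s| = r.+2.
  apply/eqP; rewrite -(eqn_add2l #|s|) cardsC; have := cardsC s'.
  by rewrite def_s' cardsU1 es -def_s' cs' => <-; lia.
have nT (t : {set 'I_n.+1}) m' : #|~: t| = m'.+1 -> t != setT.
  by move=> ct; apply/eqP => tT; rewrite tT setCT cards0 in ct.
move: x; apply: (npure_ext (f := @chcast _ r \o edge_map M def_s')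
  (g := nface M r.+1 (cnt (~: s') e) \o @chcast _ r.+1)) => m al.
have cS : (ncomp s).-1 = r.+1 by rewrite (ncomp_card (nT _ _ cs)) cs.
rewrite [LHS]/= [RHS]/= [in RHS](chcast_npure _ _ cS).
rewrite /edge_map /npure [X in chcast r X]tlift_pure /= (merge_npure _ _ def_s' es cs').
rewrite chcast_npure; last by rewrite (ncomp_card (nT _ _ cs')) cs'.
by rewrite -nface_npure // -cs' cnt_leq_card.
Qed.

(** When [e] is the only missing edge there is a single component, which [e] joins to itself. *)
Lemma edge_map_full s s' e (def_s' : s' = e |: s) (x : Phi M s) :
  s' = setT -> e \notin s -> edge_map M def_s' x = 0.
Proof.
move=> s'T es; have def_T := def_s'; rewrite s'T in def_T; have sC : ~: s = [set e].
  apply/setP => f; have /setP/(_ f) := def_T; rewrite !inE.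
  by case: eqVneq => [->|_] /=; [rewrite es | move=> <-].
have sT : s != setT by apply: contraNneq es => ->; rewrite inE.
move: x; apply: (npure_ext (f := edge_map M def_s') (g := \0)) => m al.
rewrite /edge_map /npure [LHS]tlift_pure /= /Defs.merge ifT //.
by apply/eqP/comp_idxP/(arc_connect sT); rewrite /arc sC cards1 !modn1.
Qed.

End EdgeMaps.

(** * Comparison of the signs *)

Section Signs.
Variables (n : nat) (leE : rel 'I_n.+1).
Hypotheses (leE_total : total leE) (leE_anti : antisymmetric leE).
Implicit Types (s : {set 'I_n.+1}) (e f : 'I_n.+1).

Lemma cnt_setC s v : (v <= n.+1)%N -> (cnt (~: s) v + cnt s v)%N = v.
Proof.
elim: v => [|v IHv] vn; first by rewrite !cnt0.
have := (cntS s (Ordinal vn), cntS (~: s) (Ordinal vn)) => /= -[-> ->].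
by rewrite inE addnACA IHv ?(ltnW vn) //; case: (_ \in s); rewrite addn1.
Qed.

(* Up to this sign, the signs of the coboundary, which count the present edges
   before e for leE, become those of the simplicial boundary, which count the
   missing edges before e for the natural order: it consists of the parity of
   the inversions between the two orders, and of the sum of the edges. *)
Definition twist s : nat :=
  (\sum_(f in s) \sum_(e in s) ((f < e)%N && leE e f) + \sum_(e in s) e)%N.

(** For [f] in [s], the pair of [e] and [f] is an inversion exactly when one, and only one, of the
    two orders puts [f] before [e]. Modulo 2 the inversions thus exchange the two counts of present
    edges before [e], and adding [e] itself turns present into missing. *)
Lemma odd_twist s e : e \notin s ->
  odd (twist (e |: s)) =
    odd (twist s) (+) odd (edge_sign leE s e) (+) odd (cnt (~: (e |: s)) e).
Proof.
move=> es; rewrite /twist !big_setU1 //=.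
under [X in (_ + X + _)%N]eq_bigr do rewrite big_setU1 //.
rewrite big_split /= ltnn /= add0n.
have edge_signE : edge_sign leE s e = (\sum_(f in s) leE f e)%N.
  rewrite /edge_sign -sum1_card big_mkcond [RHS]big_mkcond; apply: eq_bigr => f _.
  rewrite !inE; case: (boolP (f \in s)) => //= fs.
  have -> : f != e by apply: contraNneq es => <-.
  by rewrite andbT; case: leE.
have cntE : (cnt (~: (e |: s)) e + \sum_(f in s) (f < e)%N = e)%N.
  have -> : (\sum_(f in s) (f < e) = cnt s e)%N.
    rewrite /cnt -sum1_card big_mkcond [RHS]big_mkcond; apply: eq_bigr => f _.
    by rewrite inE; case: (f \in s) => //=; case: ltnP.
  by rewrite -(cnt_setU1 s) cnt_setC // ltnW.
have key : odd (\sum_(f in s) ((e < f)%N && leE f e) +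
    \sum_(f in s) ((f < e)%N && leE e f) + edge_sign leE s e + \sum_(f in s) (f < e)%N) = false.
  rewrite edge_signE -!big_split /=; elim/big_ind: _ => // [x y|f fs].
    by rewrite oddD => -> ->.
  have fe : f != e by apply: contraNneq es => <-.
  have := leE_total f e; have : ~~ (leE f e && leE e f).
    by apply: contra fe => /leE_anti ->.
  move: fe; rewrite -val_eqE /=.
  by case: (leE f e) (leE e f) => [] [] //=; case: (ltngtP f e).
have := congr1 odd cntE; rewrite oddD => odd_e.
by move: key; rewrite !oddD -odd_e; do 7! case: (odd _).
Qed.
End Signs.

(** * Comparison of the homologies *)

Section SubquotientMap.
Variables (k : comPzRingType) (V1 V2 : lmodType k).
Variables (S1 T1 : submodClosed V1) (S2 T2 : submodClosed V2).
Variable f : {linear V1 -> V2}.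
Hypothesis f_S : forall x, x \in S1 -> f x \in S2.
(** The equality yields at once that the induced map is well defined and that it is injective. *)
Hypothesis f_T : forall x, x \in S1 -> (f x \in T2) = (x \in T1).

Definition submod_map (x : submod S1) : submod S2 := Submod (f_S (submod_valP x)).

Definition subquot_map (x : subquot S1 T1) : subquot S2 T2 :=
  qproj _ (submod_map (repr x)).

Lemma subquot_map_qproj x : subquot_map (qproj _ x) = qproj _ (submod_map x).
Proof.
apply/qproj_eq; rewrite -[_ \in _]/(f (submod_val (repr (qproj (relsub T1) x)))
  - f (submod_val x) \in T2).
rewrite -linearB f_T.
  suff : repr (qproj (relsub T1) x) - x \in relsub T1 by [].
  by apply/qproj_eq; rewrite qproj_repr.
exact: (submod_valP (repr (qproj (relsub T1) x) - x)).
Qed.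

Fact subquot_map_linear : linear subquot_map.
Proof.
move=> c x y; rewrite -[x]qproj_repr -[y]qproj_repr -linearP !subquot_map_qproj.
by rewrite -linearP; congr qproj; apply: val_inj; rewrite /= linearP.
Qed.

HB.instance Definition _ := GRing.isLinear.Build k (subquot S1 T1)
  (subquot S2 T2) *:%R subquot_map subquot_map_linear.

Lemma subquot_iso : (forall y, y \in S2 -> exists2 x, x \in S1 & y - f x \in T2) ->
  lmod_iso (subquot S1 T1) (subquot S2 T2).
Proof.
move=> surj; exists subquot_map.
have inj x : subquot_map x = 0 -> x = 0.
  rewrite -[x]qproj_repr subquot_map_qproj -(linear0 (qproj _)) => /qproj_eq.
  rewrite subr0 => fx; rewrite -(linear0 (qproj _)); apply/qproj_eq; rewrite subr0.
  move: fx; rewrite -[_ \in _]/(f (submod_val (repr x)) \in T2).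
  by rewrite f_T //; apply: submod_valP.
have /choice[g gK] : forall y, exists x, subquot_map x = y.
  move=> y; have [x Sx yx] := surj _ (submod_valP (repr y)).
  exists (qproj _ (Submod Sx)); rewrite subquot_map_qproj -[RHS]qproj_repr.
  apply/esym/qproj_eq.
  by rewrite -[_ \in _]/(submod_val (repr y) - f x \in T2).
exists g => // x; apply/eqP; rewrite -subr_eq0; apply/eqP/inj.
by rewrite linearB /= gK subrr.
Qed.

End SubquotientMap.

Lemma linear_sumZ (k : comPzRingType) (V W : lmodType k) (f : {linear V -> W})
    (I : finType) (c : I -> k) (v : I -> V) a :
  a *: f (\sum_i c i *: v i) = \sum_i (a * c i) *: f (v i).
Proof.
rewrite linear_sum scaler_sumr; apply: eq_bigr => i _.
by rewrite linearZ scalerA.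
Qed.

Lemma scaled_linear (k : comPzRingType) (V W : lmodType k) (f : {linear V -> W})
  a : linear (fun x => a *: f x).
Proof. by move=> c x y; rewrite linearP scalerDr !scalerA mulrC. Qed.

(** * From the graph complex to D *)

Section GraphComparison.
Variables (k : comPzRingType) (A : algType k) (M : bimodType A) (n : nat).
Variable leE : rel 'I_n.+1.
Hypotheses (leE_total : total leE) (leE_anti : antisymmetric leE).
Local Notation edges := {set 'I_n.+1}.

(** The value 0 is for sets whose complement does not have [i] elements. *)
Definition to_chains i r (x : cochains M n i) (T : edges) : chains M r :=
  if (insub (~: T) : option {s : edges | #|s| == i}) is Some s
  then (-1) ^+ twist leE (val s) *: chcast r (x s : chains M (ncomp (val s)).-1)
  else 0.

Definition of_chains i r (z : edges -> chains M r) : cochains M n i :=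
  fun S => chcast (ncomp (val S)).-1 ((-1) ^+ twist leE (val S) *: z (~: val S)).

Arguments of_chains i {r} z.

Lemma to_chainsE i r (x : cochains M n i) (S : {s : edges | #|s| == i}) :
  to_chains r x (~: val S) =
    (-1) ^+ twist leE (val S) *: chcast r (x S : chains M (ncomp (val S)).-1).
Proof. by rewrite /to_chains setCK valK. Qed.

Fact to_chains_linear i r T : linear (fun x : cochains M n i => to_chains r x T).
Proof.
move=> c x y; rewrite /to_chains; case: insub => [S|]; last by rewrite scaler0 addr0.
exact: (scaled_linear (@chcast k A M (ncomp (val S)).-1 r)).
Qed.

Lemma to_chains0 i r T : to_chains r (0 : cochains M n i) T = 0.
Proof.
have := @to_chains_linear i r T (-1) 0 0.
by rewrite scaler0 addr0 scaleN1r addNr.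
Qed.

Lemma card_compl i r (S : {s : edges | #|s| == i}) : (i + r = n)%N ->
  #|~: val S| = r.+1.
Proof. by move=> irn; have := cardsC (val S); rewrite (eqP (valP S)) card_ord; lia. Qed.

Lemma compl_sub i r (T : edges) : (i + r = n)%N -> #|T| = r.+1 ->
  exists S : {s : edges | #|s| == i}, T = ~: val S.
Proof.
move=> irn cT; have cS : #|~: T| == i.
  by have := cardsC T; rewrite cT card_ord; lia.
by exists (exist (fun s : edges => #|s| == i) (~: T) cS); rewrite setCK.
Qed.

Lemma ncomp_pred i r (S : {s : edges | #|s| == i}) : (i + r = n)%N ->
  (ncomp (val S)).-1 = r.
Proof.
move=> irn; have cS := card_compl S irn; rewrite ncomp_card ?cS //.
by apply/eqP => ST; rewrite ST setCT cards0 in cS.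
Qed.

Lemma of_chainsK i r (z : edges -> chains M r) (T : edges) :
    (i + r = n)%N -> #|T| = r.+1 ->
  to_chains r (of_chains i z) T = z T.
Proof.
move=> irn /(compl_sub irn)[S ->]; rewrite to_chainsE /of_chains.
by rewrite chcastK ?signZK // (ncomp_pred _ irn).
Qed.

Lemma to_chains_inj i r (x y : cochains M n i) : (i + r = n)%N ->
  (forall T : edges, #|T| = r.+1 -> to_chains r x T = to_chains r y T) -> x = y.
Proof.
move=> irn xy; apply/functional_extensionality_dep => S.
have := xy _ (card_compl S irn); rewrite !to_chainsE.
move/(can_inj (@signZK _ _ _)); exact: (can_inj (chcastK (ncomp_pred S irn))).
Qed.

Lemma to_chains_cobd i r (x : cochains M n i) (T : edges) :
    (i.+1 + r = n)%N -> #|T| = r.+1 ->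
  to_chains r (cobd M leE i x) T = bdD (@nface k A M) (to_chains r.+1 x) T.
Proof.
move=> irn cT; have [S TS] := compl_sub irn cT; rewrite TS to_chainsE.
rewrite /bdD [RHS](eq_bigl (fun e => e \in val S)) => [|e]; last first.
  by rewrite inE negbK.
rewrite [RHS]big_sub.
pose rem (e : {e | e \in val S}) : {s : edges | #|s| == i} :=
  exist _ (val S :\ val e) (card_rem_edge (valP S) (valP e)).
pose sgn (e : {e | e \in val S}) : k :=
  (-1) ^+ edge_sign leE (val S :\ val e) (val e).
pose v e : chains M (ncomp (val S)).-1 :=
  edge_map M (esym (setD1K (valP e))) (x (rem e)).
transitivity (\sum_e ((-1) ^+ twist leE (val S) * sgn e) *: chcast r (v e)).
  exact: (linear_sumZ (@chcast k A M (ncomp (val S)).-1 r) (fun e => sgn e) v).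
apply: eq_bigr => e _; have eS : val e \notin val S :\ val e by rewrite setD11.
have cS : #|~: val S| = r.+1 by rewrite -TS.
have -> : chcast r (v e) = nface M r.+1 (cnt (~: val S) (val e))
    (chcast r.+1 (x (rem e) : chains M (ncomp (val (rem e))).-1)).
  exact: (edge_map_nface (esym (setD1K (valP e))) _ eS cS).
have -> : val e |: ~: val S = ~: val (rem e).
  by apply/setP => f; rewrite !inE negb_and negbK.
rewrite to_chainsE linearZZ scalerA; congr (_ *: _).
(* By [odd_twist]; the [edge_sign] then occurs twice and disappears, leaving the sign of [bdD]. *)
have -> : (-1) ^+ twist leE (val S) = (-1) ^+ (twist leE (val (rem e)) +
    edge_sign leE (val S :\ val e) (val e) + cnt (~: val S) (val e)) :> k.
  have := odd_twist leE_total leE_anti eS; rewrite (setD1K (valP e)) => tw.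
  by rewrite -signr_odd -[RHS]signr_odd tw !oddD.
rewrite !exprD mulrAC -[X in X * _ = _]mulrA /sgn -expr2 sqrr_sign mulr1.
by rewrite mulrC.
Qed.

Lemma cobd_top (x : cochains M n n) : cobd M leE n x = 0.
Proof.
apply/functional_extensionality_dep => S; rewrite /cobd /= /cobd_fun.
rewrite big1 // => e _.
have /eqP cS := valP S.
have ST : val S = setT by apply/eqP; rewrite eqEcard subsetT cardsT card_ord cS leqnn.
by rewrite edge_map_full ?scaler0 // setD11.
Qed.

Lemma cobd_eq0 i r (x : cochains M n i) : (i + r = n)%N ->
  cobd M leE i x = 0 <-> cycleD (@nface k A M) (to_chains r x).
Proof.
move=> irn; case: r irn => [|r] irn.
  (* In top degree every cochain is a cocycle by [cobd_top], and every chain of D is a cycle since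
     faces of degree 0 vanish. *)
  rewrite addn0 in irn; move: x; rewrite irn => x; split=> _; last exact: cobd_top.
  by move=> S _; rewrite /bdD big1 // => e _; rewrite nface0 scaler0.
have irn' : (i.+1 + r = n)%N by lia.
split=> [x0 S cS|cx].
  by rewrite -to_chains_cobd // x0 to_chains0.
apply: (to_chains_inj irn') => T cT; by rewrite to_chains_cobd // cx // to_chains0.
Qed.

Variable P : forall r, submodClosed (chains M r).
Hypothesis face_P : forall r i x,
  (i <= r)%N -> x \in P r -> nface M r i x \in P r.-1.
Hypothesis degen_P : forall r i x,
  (i <= r)%N -> x \in P r -> ndegen M r i x \in P r.+1.

Definition to_homology i r (x : cochains M n i) : chains M r :=
  sumD (to_chains r x).

Fact to_homology_linear i r : linear (@to_homology i r).
Proof.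
move=> c x y; rewrite /to_homology /sumD scaler_sumr -big_split.
by apply: eq_bigr => T _; rewrite to_chains_linear.
Qed.

HB.instance Definition _ i r := GRing.isLinear.Build k (cochains M n i)
  (chains M r) *:%R (@to_homology i r) (@to_homology_linear i r).

Lemma bd_to_homology i r (x : cochains M n i) :
  cycleD (@nface k A M) (to_chains r x) -> bd (@nface k A M) (to_homology r x) = 0.
Proof.
case: r => [|r] cx; first by rewrite /bd big_ord1 nface0 scaler0.
by rewrite /to_homology -sumD_bdD /sumD big1 // => T /eqP/cx.
Qed.

(** The submodules enter only through their membership, so that this covers both the full complexes
    and their parts of fixed degree. *)
Lemma graph_homology_iso i r (Q : submodClosed (cochains M n i))
    (K : submodClosed (cochains M n i.+1)) (L : submodClosed (chains M r)) :
    (i.+1 + r = n)%N ->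
    (forall x, x \in Q <-> inP P (to_chains r.+1 x)) ->
    (forall x, x \in K <-> inP P (to_chains r x) /\ cobd M leE i.+1 x = 0) ->
    (forall y, y \in L <-> y \in P r /\ hboundary M r y = 0) ->
  lmod_iso (subquot K (imgp (cobd M leE i) Q))
           (subquot L (imgp (hboundary M r.+1) (P r.+1))).
Proof.
move=> irn QP KP LP.
have irn1 : (i + r.+1 = n)%N by lia.
have rn : (r < n)%N by lia.
apply: (@subquot_iso _ _ _ _ _ _ _ (@to_homology i.+1 r))
  => [x /KP[Px cx]|x /KP[Px cx]|y /LP[Py cy]].
- apply/LP; split; first exact: sumD_P.
  by rewrite hboundaryE; apply/bd_to_homology/(cobd_eq0 _ irn).
- have cx' := (cobd_eq0 x irn).1 cx.
  (* Injectivity on classes is [sumD_inj]; the converse, that coboundaries are sent to boundaries,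
     is [sumD_bdD]. *)
  apply/asboolP/asboolP => [[w Pw xw]|[x' Qx' xE]].
    have [u [Pu xu]] := sumD_inj (@nface0 k A M) (@nface_nface k A M)
      (@nface_ndegen_lt k A M) (@nface_ndegen_id k A M)
      (@nface_ndegen_idS k A M) (@nface_ndegen_gt k A M) face_P degen_P
      rn Px cx' Pw (etrans xw (hboundaryE w)).
    exists (of_chains i u).
      by apply/QP => T cT; rewrite of_chainsK ?Pu.
    apply: (to_chains_inj irn) => T cT.
    apply: (etrans (xu T cT)); apply/esym/(etrans (to_chains_cobd _ irn cT)).
    by apply: eq_bdD => // U; apply: of_chainsK.
  exists (sumD (to_chains r.+1 x')); first exact: (sumD_P ((QP x').1 Qx')).
  rewrite hboundaryE -sumD_bdD xE; apply: eq_bigr => T /eqP cT.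
  by rewrite to_chains_cobd.
rewrite hboundaryE in cy.
have [z [w [Pz cz Pw yw]]] := sumD_surj (@nface0 k A M) (@nface_nface k A M)
  (@nface_ndegen_lt k A M) (@nface_ndegen_id k A M)
  (@nface_ndegen_idS k A M) (@nface_ndegen_gt k A M) face_P degen_P
  (ltnW rn) Py cy.
have zE (T : edges) : #|T| = r.+1 -> to_chains r (of_chains i.+1 z) T = z T.
  exact: of_chainsK.
exists (of_chains i.+1 z).
  apply/KP; split; first by move=> T cT; rewrite zE ?Pz.
  apply/(cobd_eq0 _ irn) => S cS; rewrite -(cz S cS).
  exact: eq_bdD.
apply/asboolP; exists w => //; rewrite hboundaryE -yw; congr (_ - _).
by apply: eq_bigr => T /eqP/zE.
Qed.

End GraphComparison.

(** * Graded pieces and conclusion *)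

Lemma cochains_degP (k : comPzRingType) (A : algType k) (M : bimodType A)
    (grA : int -> submodClosed A) (grM : int -> submodClosed M)
    n (leE : rel 'I_n.+1) i r j (x : cochains M n i) : (i + r = n)%N ->
  x \in cochains_deg grA grM n i j <->
  inP (fun r => tensor_deg grA grM r j) (to_chains leE r x).
Proof.
move=> irn; split=> [/forallP xP T cT|xP].
  have [S ->] := compl_sub irn cT; rewrite to_chainsE rpredZ //.
  by apply: chcast_deg (xP S); apply: ncomp_pred.
apply/forallP => S; have := xP _ (card_compl S irn); rewrite to_chainsE => xS.
have rS := ncomp_pred S irn.
have := rpredZ ((-1) ^+ twist leE (val S)) xS; rewrite signZK.
by move/(chcast_deg (esym rS)); rewrite chcastK.
Qed.

Theorem theorem3p1 (k : comPzRingType) (A : algType k) (M : bimodType A)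
    (A_free : free_module A) (n i : nat) (leE : rel 'I_n.+1)
    (leE_total : total leE) (leE_anti : antisymmetric leE)
    (leE_trans : transitive leE) (i_range : (0 < i <= n)%N) :
  lmod_iso (graph_coh M leE i) (HH M (n - i)) /\
  (forall (grA : int -> submodClosed A) (grM : int -> submodClosed M),
     graded_algebra grA -> graded_bimodule grA grM ->
     forall j : int,
       lmod_iso (graph_coh_deg grA grM leE i j) (HH_deg grA grM (n - i) j)).
Proof.
(* A positive [i] selects the successor branch of [graph_coh] and gives [n - i < n]. *)
case: i i_range => // i /= i_n; have irn : (i.+1 + (n - i.+1) = n)%N by lia.
split=> [|grA grM hA hM j].
  apply: (@graph_homology_iso k A M n leE leE_total leE_anti
    (fun r => @fullp k (chains M r))) => // [x|y].
    by split=> [/eqP|[_ x0]] //; apply/eqP.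
  by split=> [/eqP|[_ y0]] //; apply/eqP.
apply: (@graph_homology_iso k A M n leE leE_total leE_anti
  (fun r => tensor_deg grA grM r j)) => // [r l x|r l x|x|x|y].
- exact: nface_deg.
- exact: ndegen_deg.
- by apply: cochains_degP; lia.
- have xP := cochains_degP grA grM leE j x irn.
  split=> [/andP[/xP Px /eqP x0]|[/xP Px x0]]; first by split.
  by apply/andP; split=> //; apply/eqP.
by split=> [/andP[yP /eqP]|[yP y0]] //; apply/andP; split=> //; apply/eqP.
Qed.
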